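(* Let $E$ be a Hilbert space, let $\Omega$ be the open cone (in the space $\mathcal{H}(E)$ of hermitian bounded operators on $E$) of positive invertible operators, let $\Lambda:\mathcal{P}^1(\Omega)\to\Omega$ be the Karcher barycenter map, and let $\mu\in\mathcal{P}^1(\Omega)$. Then $x=\Lambda(\mu)$ satisfies the Karcher equation $$\int_\Omega\log(x^{-1/2}ax^{-1/2})\,d\mu(a)=0.$$
   Context: The integral is a Bochner integral in $\mathcal{H}(E)$ with the operator norm. $x\le y$ means $y-x$ is positive. $\Omega$ carries the Thompson metric $d(x,y)=\log\max\{M(x/y),M(y/x)\}$, $M(x/y)=\inf\{t>0: x\le ty\}$, which is complete and induces the norm topology. For a metric space $(X,d)$: the support of a Borel measure is the set of points all of whose open neighbourhoods have positive measure. $\mathcal{P}(X)$ is the set of Borel probability measures whose support has measure $1$; $\mathcal{P}^1(X)$ is the set of $\mu\in\mathcal{P}(X)$ with $\int_X d(x,y)\,d\mu(x)<\infty$ for some (hence all) $y$; $\mathcal{P}_0(X)$ is the set of measures $\frac1n\sum_{j=1}^n\delta_{x_j}$ (repetitions allowed). The Wasserstein distance on $\mathcal{P}^1(X)$ is $d_w(\mu,\nu)=\inf_{\pi}\int_{X\times X}d(x,y)\,d\pi(x,y)$, the infimum over couplings $\pi\in\mathcal{P}(X\times X)$ with marginals $\mu,\nu$. $\mathcal{P}_0(X)$ is $d_w$-dense in $\mathcal{P}^1(X)$. On $\Omega$ these notions refer to the Thompson metric. Karcher mean and barycenter map (known facts): for $\mu=\frac1n\sum_{i=1}^n\delta_{a_i}\in\mathcal{P}_0(\Omega)$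 the equation $\sum_{i=1}^n\log(x^{-1/2}a_ix^{-1/2})=0$ has a unique solution $x=\Lambda(\mu)\in\Omega$, the Karcher mean (Lawson–Lim), and $d(\Lambda(\mu),\Lambda(\nu))\le d_w(\mu,\nu)$ on $\mathcal{P}_0(\Omega)$. The Karcher barycenter map $\Lambda:\mathcal{P}^1(\Omega)\to\Omega$ is the unique extension satisfying $d(\Lambda(\mu),\Lambda(\nu))\le d_w(\mu,\nu)$ for all $\mu,\nu\in\mathcal{P}^1(\Omega)$. *)

(* Defs.v *)
From HB Require Import structures.
From mathcomp Require Import all_boot all_order all_algebra.
From mathcomp Require Import all_classical all_reals all_analysis.
From mathcomp Require Import complex ring lra.

Set Implicit Arguments.
Unset Strict Implicit.
Unset Printing Implicit Defensive.

Import Order.TTheory GRing.Theory Num.Theory.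
Import numFieldNormedType.Exports.

Local Open Scope classical_set_scope.
Local Open Scope ring_scope.
Local Open Scope complex_scope.

(** * Borel probability measures on metric spaces *)

(* Measurable types are pointed in the library. *)
#[short(type="pmetricType")]
HB.structure Definition PointedMetric (K : numDomainType) :=
  {M of Metric K M & isPointed M}.

HB.instance Definition _ (T U : ptopologicalType) := Pointed.on (T * U)%type.

Definition borel (T : ptopologicalType) := g_sigma_algebraType (@open T).

HB.instance Definition _ (T : ptopologicalType) := Measurable.on (borel T).

Section supported.
Context {R : realType} {T : ptopologicalType}.
Implicit Types mu : probability (borel T) R.

Definition support mu : set T :=
  [set x | forall U : set T, open U -> U x -> (0 < mu U)%E].

Definition supported mu : Prop := mu (support mu) = 1%E.

End supported.

Section wasserstein.
Context {R : realType} {X : pmetricType R}.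
Implicit Types mu nu : probability (borel X) R.

Definition finite_first_moment mu : Prop :=
  supported mu /\
  exists y : X, (\int[mu]_(x in setT) (mdist (x : X) y)%:E < +oo)%E.

(* [mu] is the average of the Dirac masses at the points [a i]. *)
Definition uniform_on mu n (a : 'I_n -> X) : Prop :=
  forall A : set (borel X), measurable A ->
    mu A = ((n%:R^-1)%:E * \sum_(i < n) \d_(a i : borel X) A)%E.

Definition coupling mu nu (pi : probability (borel (X * X)%type) R) : Prop :=
  [/\ supported pi,
      forall A : set (borel X), measurable A ->
        pi [set z : X * X | A z.1] = mu A &
      forall A : set (borel X), measurable A ->
        pi [set z : X * X | A z.2] = nu A].

(* The integral is over the Borel sets of [X * X]: for a nonseparable [X] the
   distance need not be measurable for the product sigma-algebra. *)
Definition wasserstein mu nu : \bar R :=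
  ereal_inf [set (\int[pi]_(z in setT)
                    (mdist (z : X * X).1 (z : X * X).2)%:E)%E
            | pi in coupling mu nu].

End wasserstein.

(** * Bochner integral *)

Section bochner.
Context d {T : measurableType d} {R : realType} {V : normedModType R}.
Variable mu : probability T R.

Definition simple_fun (s : T -> V) : Prop :=
  finite_set (range s) /\ forall v, measurable (s @^-1` [set v]).

Definition simple_integral (s : T -> V) : V :=
  \sum_(v \in range s) fine (mu (s @^-1` [set v])) *: v.

(* [f] is Bochner integrable with integral [I]. *)
Definition is_bochner_integral (f : T -> V) (I : V) : Prop :=
  exists s : nat -> T -> V,
  [/\ forall n, simple_fun (s n),
      {ae mu, forall t, s n t @[n --> \oo] --> f t},
      (\int[mu]_(t in setT) `|f t - s n t|%:E)%E @[n --> \oo] --> 0%E &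
      simple_integral (s n) @[n --> \oo] --> I].

End bochner.


(** * Hilbert spaces *)

(* Complex Hilbert spaces; the inner product is linear in its first argument. *)
HB.mixin Record CompleteNormedModule_isHilbert (R : realType) E
    & CompleteNormedModule R[i] E := {
  dotp : E -> E -> R[i];
  dotp_linearl : forall (a : R[i]) (u v w : E),
    dotp (a *: u + v) w = a * dotp u w + dotp v w;
  dotp_conj : forall u v : E, dotp v u = ((dotp u v)^*)%R;
  dotp_norm : forall u : E, dotp u u = `|u| ^+ 2
}.

#[short(type="hilbertType")]
HB.structure Definition Hilbert (R : realType) :=
  {E of CompleteNormedModule_isHilbert R E & CompleteNormedModule R[i] E}.

Section inner_product.
Context {R : realType} {E : hilbertType R}.
Implicit Types (u v w : E) (a : R[i]).

Lemma dotpDl u v w : dotp (u + v) w = dotp u w + dotp v w.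
Proof. by have := dotp_linearl 1 u v w; rewrite scale1r mul1r. Qed.

Lemma dotp0l w : dotp 0 w = 0.
Proof. by apply: (addrI (dotp 0 w)); rewrite -dotpDl !addr0. Qed.

Lemma dotpZl a u w : dotp (a *: u) w = a * dotp u w.
Proof. by have := dotp_linearl a u 0 w; rewrite !addr0 dotp0l addr0. Qed.

Lemma dotpNl u w : dotp (- u) w = - dotp u w.
Proof. by rewrite -scaleN1r dotpZl mulN1r. Qed.

Lemma dotpDr u v w : dotp u (v + w) = dotp u v + dotp u w.
Proof. by rewrite dotp_conj dotpDl rmorphD /= -!dotp_conj. Qed.

Lemma dotpZr a u w : dotp u (a *: w) = (a^*)%R * dotp u w.
Proof. by rewrite dotp_conj dotpZl rmorphM /= -!dotp_conj. Qed.

Lemma conj_real (r : R) : ((r%:C)^*)%R = r%:C :> R[i].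
Proof. exact: conjc_real. Qed.

Lemma dotpNr u w : dotp u (- w) = - dotp u w.
Proof. by rewrite dotp_conj dotpNl rmorphN /= -dotp_conj. Qed.

Lemma dotp0r u : dotp u 0 = 0.
Proof. by rewrite dotp_conj dotp0l rmorph0. Qed.

Lemma dotp_eq0 u : dotp u u = 0 -> u = 0.
Proof.
by move=> /eqP; rewrite dotp_norm sqrf_eq0 normr_eq0 => /eqP.
Qed.

(* The norm of the library takes its values in [R[i]]; this is the same norm
   as an element of [R]. *)
Definition hnorm u : R := complex.Re `|u|.

Lemma hnormE u : `|u| = (hnorm u)%:C.
Proof. by rewrite /hnorm RRe_real // normr_real. Qed.

Lemma hnorm_ge0 u : 0 <= hnorm u.
Proof. by rewrite -ler0c -hnormE. Qed.

Lemma hnorm0 : hnorm 0 = 0.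
Proof. by rewrite /hnorm normr0. Qed.

Lemma hnorm_eq0 u : hnorm u = 0 -> u = 0.
Proof. by move=> h; apply/eqP; rewrite -normr_eq0 hnormE h. Qed.

Lemma hnormD u v : hnorm (u + v) <= hnorm u + hnorm v.
Proof. by rewrite -lecR rmorphD /= -!hnormE ler_normD. Qed.

Lemma hnormZ (r : R) u : hnorm (r%:C *: u) = `|r| * hnorm u.
Proof.
apply: complexI; rewrite rmorphM /= -!hnormE normrZ; congr (_ * _).
by rewrite normc_def /= expr0n addr0 sqrtr_sqr.
Qed.

Lemma dotp_hnorm u : dotp u u = (hnorm u ^+ 2)%:C.
Proof. by rewrite dotp_norm hnormE rmorphXn. Qed.

End inner_product.

(** * Bounded and hermitian operators *)

Section operators.
Context {R : realType} {E : hilbertType R}.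

Definition bounded_operator (f : E -> E) :=
  linear f /\ exists M : R, forall u, hnorm (f u) <= M * hnorm u.

Definition self_adjoint (f : E -> E) :=
  forall u v, dotp (f u) v = dotp u (f v).

End operators.

Section hermitian_def.
Context {R : realType} (E : hilbertType R).

Record hermOp := HermOp {
  hop :> E -> E;
  hop_bounded : bounded_operator hop;
  hop_adj : self_adjoint hop
}.

HB.instance Definition _ := gen_eqMixin hermOp.
HB.instance Definition _ := gen_choiceMixin hermOp.

End hermitian_def.

Section hermitian.
Context {R : realType} {E : hilbertType R}.
Implicit Types (A B : hermOp E) (u v : E).

Lemma hermOp_ext A B : (forall u, A u = B u) -> A = B.
Proof.
case: A B => [f fb fa] [g gb ga] /= fg.
have {}fg : f = g by apply/funext.
by subst g; rewrite (Prop_irrelevance fb gb) (Prop_irrelevance fa ga).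
Qed.

Lemma hop_linear A : linear A. Proof. by case: (hop_bounded A). Qed.

HB.instance Definition _ A :=
  GRing.isLinear.Build R[i] E E *:%R (hop A) (hop_linear A).

Lemma bounded_ge0 (f : E -> E) : bounded_operator f ->
  exists2 M : R, 0 <= M & forall u, hnorm (f u) <= M * hnorm u.
Proof.
move=> [_ [M fM]]; exists `|M| => // u.
by rewrite (le_trans (fM u))// ler_wpM2r ?hnorm_ge0// ler_norm.
Qed.

Lemma bounded_operator_comp (f g : E -> E) :
  bounded_operator f -> bounded_operator g -> bounded_operator (f \o g).
Proof.
move=> bf bg.
have [M M0 fM] := bounded_ge0 bf; have [N N0 gN] := bounded_ge0 bg.
split=> [a u v /=|]; first by rewrite (proj1 bg) (proj1 bf).
exists (M * N) => u /=; rewrite (le_trans (fM _))// -mulrA.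
by rewrite ler_wpM2l.
Qed.

Fact zero_op_bounded : bounded_operator (fun _ : E => 0 : E).
Proof.
split=> [a u v|]; first by rewrite scaler0 addr0.
by exists 0 => u; rewrite hnorm0 mul0r.
Qed.

Fact zero_op_adj : self_adjoint (fun _ : E => 0 : E).
Proof. by move=> u v; rewrite dotp0l dotp0r. Qed.

Definition zero_op := HermOp zero_op_bounded zero_op_adj.

Fact id_op_bounded : bounded_operator (@idfun E).
Proof. by split=> //; exists 1 => u; rewrite mul1r. Qed.

Fact id_op_adj : self_adjoint (@idfun E). Proof. by []. Qed.

Definition id_op := HermOp id_op_bounded id_op_adj.

Fact add_op_bounded A B : bounded_operator (fun u => A u + B u).
Proof.
split=> [a u v|].
  by rewrite !linearP scalerDr addrACA.
have [M M0 AM] := bounded_ge0 (hop_bounded A).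
have [N N0 BN] := bounded_ge0 (hop_bounded B).
exists (M + N) => u.
by rewrite (le_trans (hnormD _ _))// mulrDl lerD.
Qed.

Fact add_op_adj A B : self_adjoint (fun u => A u + B u).
Proof. by move=> u v; rewrite dotpDl dotpDr !hop_adj. Qed.

Definition add_op A B := HermOp (add_op_bounded A B) (add_op_adj A B).

Fact scale_op_bounded (r : R) A : bounded_operator (fun u => r%:C *: A u).
Proof.
split=> [a u v|].
  by rewrite linearP scalerDr !scalerA mulrC.
have [M M0 AM] := bounded_ge0 (hop_bounded A).
exists (`|r| * M) => u.
by rewrite hnormZ -mulrA ler_wpM2l.
Qed.

Fact scale_op_adj (r : R) A : self_adjoint (fun u => r%:C *: A u).
Proof. by move=> u v; rewrite dotpZl dotpZr hop_adj conj_real. Qed.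

Definition scale_op r A := HermOp (scale_op_bounded r A) (scale_op_adj r A).

Definition opp_op A := scale_op (-1) A.

Fact add_opA : associative add_op.
Proof. by move=> A B C; apply: hermOp_ext => u /=; rewrite addrA. Qed.
Fact add_opC : commutative add_op.
Proof. by move=> A B; apply: hermOp_ext => u /=; rewrite addrC. Qed.
Fact add_0op : left_id zero_op add_op.
Proof. by move=> A; apply: hermOp_ext => u /=; rewrite add0r. Qed.
Fact add_Nop : left_inverse zero_op opp_op add_op.
Proof.
by move=> A; apply: hermOp_ext => u /=; rewrite rmorphN1 scaleN1r addNr.
Qed.

HB.instance Definition _ :=
  GRing.isZmodule.Build (hermOp E) add_opA add_opC add_0op add_Nop.

Fact scale_opA (r s : R) A : scale_op r (scale_op s A) = scale_op (r * s) A.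
Proof. by apply: hermOp_ext => u /=; rewrite scalerA rmorphM. Qed.
Fact scale_op1 : left_id 1 scale_op.
Proof. by move=> A; apply: hermOp_ext => u /=; rewrite scale1r. Qed.
Fact scale_opDr : right_distributive scale_op +%R.
Proof. by move=> r A B; apply: hermOp_ext => u /=; rewrite scalerDr. Qed.
Fact scale_opDl A : {morph scale_op^~ A : r s / r + s}.
Proof. by move=> r s; apply: hermOp_ext => u /=; rewrite rmorphD scalerDl. Qed.

HB.instance Definition _ := GRing.Zmodule_isLmodule.Build R (hermOp E)
  scale_opA scale_op1 scale_opDr scale_opDl.

Lemma hop0 u : (0 : hermOp E) u = 0. Proof. by []. Qed.
Lemma hopD A B u : (A + B) u = A u + B u. Proof. by []. Qed.
Lemma hopZ (r : R) A u : (r *: A) u = r%:C *: A u. Proof. by []. Qed.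
Lemma hopN A u : (- A) u = - A u.
Proof. by rewrite -scaleN1r hopZ rmorphN1 scaleN1r. Qed.
Lemma hopB A B u : (A - B) u = A u - B u. Proof. by rewrite hopD hopN. Qed.

Definition opnorm A : R := sup [set hnorm (A u) | u in [set u | hnorm u <= 1]].

Lemma opnorm_has_sup A :
  has_sup [set hnorm (A u) | u in [set u | hnorm u <= 1]].
Proof.
split; first by exists (hnorm (A 0)), 0 => //=; rewrite hnorm0.
have [M M0 AM] := bounded_ge0 (hop_bounded A).
exists M => _ [u /= u1 <-]; rewrite (le_trans (AM u))//.
by rewrite -[leRHS]mulr1 ler_wpM2l.
Qed.

Lemma opnorm_ge0 A : 0 <= opnorm A.
Proof.
apply: (le_trans (hnorm_ge0 (A 0))); apply: sup_upper_bound.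
  exact: opnorm_has_sup.
by exists 0 => //=; rewrite hnorm0.
Qed.

Lemma opnorm_bound A u : hnorm (A u) <= opnorm A * hnorm u.
Proof.
have [u0|un0] := eqVneq (hnorm u) 0.
  by rewrite (hnorm_eq0 u0) linear0 hnorm0 mulr0.
have u_gt0 : 0 < hnorm u by rewrite lt_neqAle eq_sym un0 hnorm_ge0.
have : hnorm (A ((hnorm u)^-1%:C *: u)) <= opnorm A.
  apply: sup_upper_bound; first exact: opnorm_has_sup.
  exists ((hnorm u)^-1%:C *: u) => //=.
  by rewrite hnormZ ger0_norm ?invr_ge0 ?hnorm_ge0// mulVf.
rewrite linearZ /= hnormZ ger0_norm ?invr_ge0 ?hnorm_ge0//.
by rewrite mulrC ler_pdivrMr.
Qed.

Lemma opnorm_le A (M : R) : 0 <= M ->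
  (forall u, hnorm (A u) <= M * hnorm u) -> opnorm A <= M.
Proof.
move=> M0 AM; apply: ge_sup; first by case: (opnorm_has_sup A).
move=> _ [u /= u1 <-]; rewrite (le_trans (AM u))//.
by rewrite -[leRHS]mulr1 ler_wpM2l.
Qed.

Fact opnormD A B : opnorm (A + B) <= opnorm A + opnorm B.
Proof.
apply: opnorm_le => [|u]; first by rewrite addr_ge0 ?opnorm_ge0.
by rewrite (le_trans (hnormD _ _))// mulrDl lerD// opnorm_bound.
Qed.

Fact opnorm_eq0 A : opnorm A = 0 -> A = 0.
Proof.
move=> A0; apply: hermOp_ext => u; apply: hnorm_eq0; apply/eqP.
by rewrite eq_le hnorm_ge0 andbT (le_trans (opnorm_bound A u))// A0 mul0r.
Qed.

Fact opnormZ (r : R) A : opnorm (r *: A) = `|r| * opnorm A.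
Proof.
have le_opnormZ (s : R) B : opnorm (s *: B) <= `|s| * opnorm B.
  apply: opnorm_le => [|u]; first by rewrite mulr_ge0 ?opnorm_ge0.
  by rewrite hnormZ -mulrA ler_wpM2l// opnorm_bound.
apply/eqP; rewrite eq_le le_opnormZ /=.
have [->|r0] := eqVneq r 0; first by rewrite normr0 mul0r opnorm_ge0.
rewrite -ler_pdivlMl ?normr_gt0// -normfV.
by rewrite -[X in opnorm X <= _](scalerK r0) le_opnormZ.
Qed.

HB.instance Definition _ := Lmodule_isNormed.Build R (hermOp E)
  opnormD opnormZ opnorm_eq0.

Lemma opnormE A : `|A| = opnorm A. Proof. by []. Qed.

(* [congr_op A B] is the hermitian operator [A B A]. *)
Fact congr_op_bounded A B : bounded_operator (A \o B \o A).
Proof.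
apply: bounded_operator_comp; last exact: hop_bounded.
by apply: bounded_operator_comp; exact: hop_bounded.
Qed.

Fact congr_op_adj A B : self_adjoint (A \o B \o A).
Proof. by move=> u v /=; rewrite !hop_adj. Qed.

Definition congr_op A B := HermOp (congr_op_bounded A B) (congr_op_adj A B).

Fact exp_op_bounded A n : bounded_operator (iter n A).
Proof.
elim: n => [|n IHn]; first exact: id_op_bounded.
exact: (bounded_operator_comp (hop_bounded A) IHn).
Qed.

Fact exp_op_adj A n : self_adjoint (iter n A).
Proof.
elim: n => [//|n IHn] u v.
by rewrite iterS hop_adj IHn -iterSr.
Qed.

Definition pow_op A n := HermOp (exp_op_bounded A n) (exp_op_adj A n).

Definition exp_op A : hermOp E :=
  limn (series (fun n => (n`!%:R)^-1 *: pow_op A n)).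

(* The logarithm of a positive invertible operator is the hermitian operator
   whose exponential it is. *)
Definition log_op A : hermOp E := xget 0 [set B | exp_op B = A].

(** * The cone of positive invertible operators *)

(* The order of [R[i]] only compares numbers with the same imaginary part. *)
Definition positive_op A := forall u, 0 <= dotp (A u) u.

Definition le_op A B := positive_op (B - A).

Definition invertible_op (f : E -> E) :=
  exists g, [/\ bounded_operator g, cancel f g & cancel g f].

End hermitian.

Section cone_def.
Context {R : realType} (E : hilbertType R).

Record posCone := PosCone {
  cone_op :> hermOp E;
  cone_pos : positive_op cone_op;
  cone_inv : invertible_op cone_op
}.

HB.instance Definition _ := gen_eqMixin posCone.
HB.instance Definition _ := gen_choiceMixin posCone.

End cone_def.

Section cone.
Context {R : realType} {E : hilbertType R}.
Implicit Types (A B : hermOp E) (u v : E) (x y z : posCone E).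

Lemma cone_op_inj : injective (@cone_op R E).
Proof.
move=> [a ap ai] [b bp bi] /= ab; subst b.
by rewrite (Prop_irrelevance ap bp) (Prop_irrelevance ai bi).
Qed.

Fact id_op_pos : positive_op (@id_op R E).
Proof. by move=> u; rewrite dotp_norm exprn_ge0. Qed.

Fact id_op_inv : invertible_op (@id_op R E).
Proof. by exists idfun; split=> //; exact: id_op_bounded. Qed.

Definition cone1 : posCone E := PosCone id_op_pos id_op_inv.

HB.instance Definition _ := isPointed.Build (posCone E) cone1.

Definition inv_cone x : posCone E :=
  xget cone1 [set y | cancel x y /\ cancel y x].

Definition sqrt_cone x : posCone E :=
  xget cone1 [set y | forall u, y (y u) = x u].

(* [M(x/y)] in the definition of the Thompson metric. *)
Definition thompson_gauge x y : R :=
  inf [set t | 0 < t /\ le_op x (t *: (y : hermOp E))].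

Definition thompson x y : R :=
  ln (Num.max (thompson_gauge x y) (thompson_gauge y x)).

(* The real number [<A u, u>]. *)
Let qf A u : R := complex.Re (dotp (A u) u).

Let qfE A u : dotp (A u) u = (qf A u)%:C.
Proof.
have := dotp_conj (A u) u; rewrite -hop_adj /qf.
case: (dotp (A u) u) => a b h; injection h => /eqP.
by rewrite -addr_eq0 -mulr2n mulrn_eq0 /= => /eqP ->.
Qed.

Let le_opE A B : le_op A B <-> forall u, qf A u <= qf B u.
Proof.
split=> AB u; have := AB u; rewrite hopB dotpDl dotpNl !qfE.
  by rewrite -rmorphB ler0c subr_ge0.
by rewrite -rmorphB ler0c subr_ge0.
Qed.

Let qfZ (r : R) A u : qf (r *: A) u = r * qf A u.
Proof. by apply: complexI; rewrite rmorphM /= -!qfE hopZ dotpZl. Qed.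

Let qf_ge0 x u : 0 <= qf x u.
Proof. by rewrite -ler0c -qfE; exact: cone_pos. Qed.

Lemma le_op_anti A B : le_op A B -> le_op B A -> A = B.
Proof.
move=> /le_opE AB /le_opE BA; apply: hermOp_ext => u.
have [D DE] : exists D, D = A - B by exists (A - B).
have D0 w : dotp (D w) w = 0.
  by rewrite DE hopB dotpDl dotpNl !qfE -rmorphB (_ : qf A w = qf B w) ?subrr//;
    apply/eqP; rewrite eq_le AB BA.
have pol w v : dotp (D w) v + dotp (D v) w = 0.
  have := D0 (w + v); rewrite linearD /= dotpDl !dotpDr !D0 add0r addr0.
  by [].
have Duv v : dotp (D u) v = 0.
  have h1 := pol u v; have h2 := pol u ('i%C *: v).
  move: h2; rewrite linearZ /= dotpZl dotpZr => h2.
  have : 'i%C * dotp (D v) u - 'i%C * dotp (D u) v = 0.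
    by rewrite -h2 addrC -mulNr; congr (_ * _ + _); simpc.
  rewrite -mulrBr => /eqP; rewrite mulf_eq0 => /orP[/eqP[] /eqP|].
    by rewrite oner_eq0.
  rewrite subr_eq0 => /eqP h3; move: h1; rewrite h3 => /eqP.
  by rewrite -mulr2n mulrn_eq0 => /eqP.
have /dotp_eq0 : dotp (D u) (D u) = 0 by [].
by rewrite DE hopB => /eqP; rewrite subr_eq0 => /eqP.
Qed.

Let qf_ubound A : exists2 K : R, 0 < K &
  forall u, qf A u <= K * hnorm u ^+ 2.
Proof.
exists (1 + opnorm A ^+ 2).
  by rewrite ltr_wpDr ?sqr_ge0.
move=> u.
have h : qf A u + qf A u <= hnorm (A u) ^+ 2 + hnorm u ^+ 2.
  rewrite -subr_ge0.
  have -> : hnorm (A u) ^+ 2 + hnorm u ^+ 2 - (qf A u + qf A u) =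
      hnorm (A u - u) ^+ 2.
    apply: complexI; rewrite -dotp_hnorm dotpDl !dotpDr !dotpNl !dotpNr opprK.
    rewrite -(hop_adj A u u) !dotp_hnorm !qfE !(rmorphD, rmorphN) /=.
    by ring.
  exact: sqr_ge0.
have h2 : hnorm (A u) ^+ 2 <= opnorm A ^+ 2 * hnorm u ^+ 2.
  by rewrite -exprMn lerXn2r ?nnegrE ?mulr_ge0 ?opnorm_ge0 ?hnorm_ge0//
    opnorm_bound.
have h3 := sqr_ge0 (hnorm u).
have h4 : 0 <= opnorm A ^+ 2 * hnorm u ^+ 2 by rewrite mulr_ge0 ?sqr_ge0.
by rewrite mulrDl mul1r; lra.
Qed.

Let qf_lbound y : exists2 c : R, 0 < c &
  forall u, c * hnorm u ^+ 2 <= qf y u.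
Proof.
have [K K0 yK] := qf_ubound y.
have [g [gb yg gy]] := cone_inv y.
have [N N0 gN] := bounded_ge0 gb.
have N1 : 0 < 1 + N ^+ 2 by rewrite ltr_wpDr ?sqr_ge0.
exists (K^-1 * (1 + N ^+ 2)^-1); first by rewrite mulr_gt0 ?invr_gt0.
move=> u; set w := y u; set s := K^-1.
have s0 : 0 < s by rewrite invr_gt0.
have yu : s * hnorm w ^+ 2 <= qf y u.
  have := qf_ge0 y (u - s%:C *: w).
  have -> : qf y (u - s%:C *: w) =
      qf y u - s * hnorm w ^+ 2 - s * hnorm w ^+ 2 + s * (s * qf y w).
    apply: complexI; rewrite -qfE linearB linearZ /=.
    rewrite !(dotpDl, dotpDr, dotpNl, dotpNr) !(dotpZl, dotpZr) conj_real.
    rewrite (hop_adj y w u) -/w !dotp_hnorm !qfE.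
    rewrite !(rmorphD, rmorphN, rmorphM) /=.
    by ring.
  have sK : s * qf y w <= hnorm w ^+ 2.
    by rewrite /s mulrC ler_pdivrMr// mulrC yK.
  have := ler_wpM2l (ltW s0) sK.
  by lra.
apply: le_trans yu; rewrite -mulrA ler_pM2l// mulrC ler_pdivrMr//.
have wu : hnorm u <= N * hnorm w by rewrite -{1}(yg u); exact: gN.
have : hnorm u ^+ 2 <= N ^+ 2 * hnorm w ^+ 2.
  by rewrite -exprMn lerXn2r ?nnegrE ?mulr_ge0 ?hnorm_ge0.
have := sqr_ge0 (hnorm w).
by rewrite mulrDr mulr1 [_ * N ^+ 2]mulrC; lra.
Qed.

Let gauge_set x y : set R := [set t | 0 < t /\ le_op x (t *: (y : hermOp E))].

Let gauge_has_inf x y : has_inf (gauge_set x y).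
Proof.
split; last by exists 0 => t [/ltW].
have [K K0 xK] := qf_ubound x; have [c c0 yc] := qf_lbound y.
exists (K / c); split; first by rewrite divr_gt0.
apply/le_opE => u; rewrite qfZ (le_trans (xK u))//.
by rewrite -mulrA ler_pM2l// ler_pdivlMl// yc.
Qed.

Let gauge_ge0 x y : 0 <= thompson_gauge x y.
Proof.
apply: lb_le_inf; first by case: (gauge_has_inf x y).
by move=> t [/ltW].
Qed.

Let gauge_le_op x y u : qf x u <= thompson_gauge x y * qf y u.
Proof.
have [y0|y0] := eqVneq (qf y u) 0.
  have [[t [t0 /le_opE xy]] _] := gauge_has_inf x y.
  by have := xy u; rewrite qfZ y0 !mulr0.
have yu : 0 < qf y u by rewrite lt_neqAle eq_sym y0 qf_ge0.
rewrite -ler_pdivrMr//; apply: lb_le_inf; first by case: (gauge_has_inf x y).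
by move=> t [t0 /le_opE /(_ u)]; rewrite qfZ ler_pdivrMr.
Qed.

Let gauge_le x y (t : R) : 0 < t -> (forall u, qf x u <= t * qf y u) ->
  thompson_gauge x y <= t.
Proof.
move=> t0 xy; apply: ge_inf; first by case: (gauge_has_inf x y).
by split=> //; apply/le_opE => u; rewrite qfZ.
Qed.

(* In the zero space the gauge and the distance are [0], because [ln 0 = 0]. *)
Let trivial_or x y : (forall A u, qf A u = 0) /\ thompson x y = 0 \/
  exists u, forall x, 0 < qf x u.
Proof.
have [[u u0]|E0] := pselect (exists u : E, u != 0).
  right; exists u => z; have [c c0 zc] := qf_lbound z.
  apply: lt_le_trans (zc u); rewrite mulr_gt0// exprn_gt0//.
  rewrite lt_neqAle hnorm_ge0 andbT eq_sym.
  by apply: contra u0 => /eqP/hnorm_eq0 ->.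
have {}E0 u : u = 0 by apply/eqP; apply/negPn/negP => u0; apply: E0; exists u.
have q0 A u : qf A u = 0 by rewrite /qf (E0 u) dotp0r.
left; split=> //.
have g0 (a b : posCone E) : thompson_gauge a b = 0.
  apply/eqP; rewrite eq_le gauge_ge0 andbT; apply/ler_addgt0Pl => e e0.
  by rewrite addr0; apply: gauge_le => // u; rewrite !q0 mulr0.
by rewrite /thompson !g0 maxxx ln0.
Qed.

Section nontrivial.
Variables (u : E) (u_gt0 : forall x, 0 < qf x u).

Let gauge_gt0 x y : 0 < thompson_gauge x y.
Proof.
have := lt_le_trans (u_gt0 x) (gauge_le_op x y u).
by rewrite pmulr_lgt0.
Qed.

Let gaugeM x y z :
  thompson_gauge x z <= thompson_gauge x y * thompson_gauge y z.
Proof.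
apply: gauge_le => [|v]; first by rewrite mulr_gt0.
by rewrite (le_trans (gauge_le_op x y v))// -mulrA ler_pM2l// gauge_le_op.
Qed.

Let gauge_max x y := Num.max (thompson_gauge x y) (thompson_gauge y x).

Let gauge_max_gt0 x y : 0 < gauge_max x y.
Proof. by rewrite lt_max gauge_gt0. Qed.

Let gauge_maxM x y z : gauge_max x z <= gauge_max x y * gauge_max y z.
Proof.
have le_max2 a b : thompson_gauge a b <= gauge_max a b by rewrite le_max lexx.
have maxC a b : gauge_max a b = gauge_max b a by rewrite /gauge_max maxC.
rewrite ge_max; apply/andP; split.
  by rewrite (le_trans (gaugeM x y z))// ler_pM ?gauge_ge0.
rewrite (le_trans (gaugeM z y x))// mulrC ler_pM ?gauge_ge0//.
  by rewrite maxC.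
by rewrite maxC.
Qed.

Let gaugexx x : thompson_gauge x x = 1.
Proof.
apply/eqP; rewrite eq_le; apply/andP; split.
  by apply: gauge_le => // v; rewrite mul1r.
have := gauge_le_op x x u.
by rewrite -[leLHS]mul1r ler_pM2r.
Qed.

Lemma thompson_nontrivial_xx x : thompson x x = 0.
Proof. by rewrite /thompson gaugexx maxxx ln1. Qed.

Lemma thompson_nontrivial_eq0 x y : thompson x y = 0 -> x = y.
Proof.
rewrite /thompson => /eqP; rewrite ln_eq0 ?gauge_max_gt0// => /eqP m1.
have le1 a b : thompson_gauge a b <= 1 -> le_op a b.
  move=> ab1; apply/le_opE => v; rewrite (le_trans (gauge_le_op a b v))//.
  by rewrite ler_piMl ?qf_ge0.
by apply: cone_op_inj; apply: le_op_anti; apply: le1;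
  rewrite -m1 le_max lexx ?orbT.
Qed.

Lemma thompson_nontrivial_triangle y x z :
  thompson x z <= thompson x y + thompson y z.
Proof.
rewrite /thompson -lnM ?posrE ?gauge_max_gt0//.
by rewrite ler_ln ?posrE ?mulr_gt0 ?gauge_max_gt0// gauge_maxM.
Qed.

End nontrivial.

Fact thompsonxx x : thompson x x = 0.
Proof.
have [[_ //]|[u u0]] := trivial_or x x.
exact: (thompson_nontrivial_xx u0).
Qed.

Fact thompson_eq0 x y : thompson x y = 0 -> x = y.
Proof.
have [[q0 _] _|[u u0]] := trivial_or x y.
  by apply: cone_op_inj; apply: le_op_anti; apply/le_opE => u; rewrite !q0.
exact: (thompson_nontrivial_eq0 u0).
Qed.

Fact thompson_sym x y : thompson x y = thompson y x.
Proof. by rewrite /thompson maxC. Qed.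

Fact thompson_triangle y x z : thompson x z <= thompson x y + thompson y z.
Proof.
have [[_ xz]|[u u0]] := trivial_or x z; last first.
  exact: (thompson_nontrivial_triangle u0).
have [[_ xy]|[u u0]] := trivial_or x y; last first.
  exact: (thompson_nontrivial_triangle u0).
have [[_ yz]|[u u0]] := trivial_or y z; last first.
  exact: (thompson_nontrivial_triangle u0).
by rewrite xz xy yz addr0.
Qed.

HB.instance Definition _ := isMetric.Build R (posCone E)
  thompsonxx thompson_eq0 thompson_sym thompson_triangle.

Lemma mdist_thompson x y : mdist x y = thompson x y. Proof. by []. Qed.

End cone.

(** * Karcher barycenter map *)

Section karcher.
Context {R : realType} {E : hilbertType R}.
Implicit Types x a : posCone E.

(* [log (x^(-1/2) a x^(-1/2))] *)
Definition karcher_log x a : hermOp E :=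
  log_op (congr_op (inv_cone (sqrt_cone x)) a).

(* The defining properties of the Karcher barycenter map: it extends the Karcher
   mean of uniform finitely supported measures and is contractive for the
   Wasserstein distance. Its values outside of the measures with finite first
   moment are unconstrained. *)
Definition karcher_barycenter_map
    (L : probability (borel (posCone E)) R -> posCone E) : Prop :=
  (forall (mu : probability (borel (posCone E)) R) n (a : 'I_n -> posCone E),
     (0 < n)%N -> uniform_on mu a ->
     \sum_(i < n) karcher_log (L mu) (a i) = 0) /\
  (forall mu nu : probability (borel (posCone E)) R,
     finite_first_moment mu -> finite_first_moment nu ->
     ((mdist (L mu) (L nu))%:E <= wasserstein mu nu)%E).

End karcher.

(* Main.v *)
Require Import Defs.
From HB Require Import structures.
From mathcomp Require Import all_boot all_order all_algebra.
From mathcomp Require Import all_classical all_reals all_analysis.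
From mathcomp Require Import measurable_realfun.
From mathcomp Require Import complex ring lra.

(* Let [x = L mu], and let [p] be a sequence that is dense in the support of
   [mu]. Sending a point to a nearest one among [p 0], ..., [p n] moves it by an
   amount that tends to [0] and is dominated by its distance to [p 0]; rounding
   the masses of the cells thus obtained gives uniform measures [nu_n] at
   Wasserstein distance tending to [0] from [mu], so that [x_n = L nu_n] tends
   to [x]. The Karcher equation holds for [nu_n] and [x_n], and it passes to the
   limit by dominated convergence because the map
   [a |-> log (x^(-1/2) a x^(-1/2))] is 1-Lipschitz for the Thompson metric,
   vanishes at [a = x], and depends continuously on [x].
   The Lipschitz bound expresses that the logarithm is operator monotone, since
   [a <= e^d b] gives [log a <= d + log b]. Monotonicity comes from that of the
   square root and from [2^k (exp (B / 2^k) - 1) -> B]. *)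

Set Implicit Arguments.
Unset Strict Implicit.
Unset Printing Implicit Defensive.

Import Order.TTheory GRing.Theory Num.Theory.
Import numFieldNormedType.Exports.

Local Open Scope classical_set_scope.
Local Open Scope ring_scope.

(** * Quadratic forms of hermitian operators *)

(** The cone need not be separable, so the approximation runs along a sequence that only captures
    the support of [mu], and couplings live on the Borel sets of the product, where their supports
    must be shown to have full measure. The cells around the points [p k] have arbitrary masses,
    whereas the Karcher equation is known for uniform measures: hence two approximating measures,
    one with the exact masses and one with rounded masses. The contraction property is applied to
    each pair of consecutive measures, and the triangle inequality is then used in [Omega], between
    barycenters. The base point varies with [n], and so do the points at which the Karcher logarithm
    is evaluated. The Lipschitz constant 1 is the same for every base point, so continuity in the
    base point at a fixed argument is enough to control both. Operator inequalities are read on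
    quadratic forms. Square roots, and logarithms near the identity, are fixpoints of contractions;
    repeated square roots bring every coercive operator near the identity. *)

Section real_inner_product.
Context {R : realType} {E : hilbertType R}.
Implicit Types (u v w : E) (r : R).
Local Open Scope complex_scope.

(** [R[i]] is only partially ordered. The real part makes [E] a real inner product space and loses
    nothing on the form of a hermitian operator, whose values are real. *)
Definition rdot u v : R := complex.Re (dotp u v).

Lemma rdotC u v : rdot u v = rdot v u.
Proof. by rewrite /rdot (dotp_conj v u); case: (dotp v u). Qed.

Lemma rdotDl u v w : rdot (u + v) w = rdot u w + rdot v w.
Proof. by rewrite /rdot dotpDl; case: (dotp u w) (dotp v w) => [? ?] []. Qed.

Lemma rdotDr u v w : rdot u (v + w) = rdot u v + rdot u w.
Proof. by rewrite rdotC rdotDl !(rdotC u). Qed.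

Lemma rdotZl r u v : rdot (r%:C *: u) v = r * rdot u v.
Proof.
by rewrite /rdot dotpZl; case: (dotp u v) => ? ? /=; rewrite mul0r subr0.
Qed.

Lemma rdotZr r u v : rdot u (r%:C *: v) = r * rdot u v.
Proof. by rewrite rdotC rdotZl rdotC. Qed.

Lemma rdotNl u v : rdot (- u) v = - rdot u v.
Proof. by rewrite /rdot dotpNl; case: (dotp u v). Qed.

Lemma rdotNr u v : rdot u (- v) = - rdot u v.
Proof. by rewrite rdotC rdotNl rdotC. Qed.

Lemma rdotBl u v w : rdot (u - v) w = rdot u w - rdot v w.
Proof. by rewrite rdotDl rdotNl. Qed.

Lemma rdotBr u v w : rdot u (v - w) = rdot u v - rdot u w.
Proof. by rewrite rdotDr rdotNr. Qed.

Lemma rdotuu u : rdot u u = hnorm u ^+ 2.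
Proof. by rewrite /rdot dotp_hnorm. Qed.

Lemma hnormN u : hnorm (- u) = hnorm u.
Proof. by rewrite /hnorm normrN. Qed.

(** Cauchy-Schwarz: the square of the norm of [|v| u - |u| v] is [2 |u| |v|] times the difference of
    the two sides, whence the separate treatment of zero vectors. *)
Lemma rdot_le u v : rdot u v <= hnorm u * hnorm v.
Proof.
have [u0|u0] := eqVneq (hnorm u) 0.
  by rewrite (hnorm_eq0 u0) /rdot dotp0l hnorm0 mul0r.
have u_gt0 : 0 < hnorm u by rewrite lt_neqAle eq_sym u0 hnorm_ge0.
have := sqr_ge0 (hnorm ((hnorm v)%:C *: u - (hnorm u)%:C *: v)).
rewrite -rdotuu rdotBl !rdotBr !rdotZl !rdotZr !rdotuu (rdotC v u) => h.
have [v0|v0] := eqVneq (hnorm v) 0.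
  by rewrite (hnorm_eq0 v0) /rdot dotp0r hnorm0 mulr0.
have v_gt0 : 0 < hnorm v by rewrite lt_neqAle eq_sym v0 hnorm_ge0.
have uv : 0 < hnorm u * hnorm v by rewrite mulr_gt0.
by rewrite -(ler_pM2l uv); lra.
Qed.

Lemma hnorm_sqrD u v :
  hnorm (u + v) ^+ 2 = hnorm u ^+ 2 + 2 * rdot u v + hnorm v ^+ 2.
Proof. rewrite -!rdotuu !(rdotDl, rdotDr) (rdotC v u); ring. Qed.

Lemma rdot_abs_le u v : `|rdot u v| <= hnorm u * hnorm v.
Proof.
rewrite ler_norml rdot_le andbT lerNl -rdotNl.
by rewrite (le_trans (rdot_le _ _))// hnormN.
Qed.

(** Real symmetry applied to [u] and [i v] recovers the imaginary parts. It serves to show that a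
    limit of hermitian operators is hermitian. *)
Lemma rdot_self_adjoint (f : E -> E) :
  linear f -> (forall u v, rdot (f u) v = rdot u (f v)) -> self_adjoint f.
Proof.
move=> lf fh u v; pose i : R[i] := 'i%C.
have fi : f (i *: v) = i *: f v.
  have f0 : f 0 = 0.
    by have := lf (-1) 0 0; rewrite scaler0 addr0 scaleN1r addNr.
  by have := lf i v 0; rewrite f0 !addr0.
have h1 := fh u v; have := fh u (i *: v); rewrite fi /rdot !dotpZr.
move: h1; rewrite /rdot; case: (dotp (f u) v) (dotp u (f v)) => a b [c d] /=.
by move=> ->; rewrite !mul0r !mulN1r !sub0r !opprK => ->.
Qed.

End real_inner_product.

Section quadratic_form.
Context {R : realType} {E : hilbertType R}.
Implicit Types (u v w : E) (r : R) (A B S T P : hermOp E).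
Local Open Scope complex_scope.

Definition qf A u : R := rdot (A u) u.

Lemma rdot_hop A u v : rdot (A u) v = rdot u (A v).
Proof. by rewrite /rdot hop_adj. Qed.

Lemma qfD A B u : qf (A + B) u = qf A u + qf B u.
Proof. by rewrite /qf hopD rdotDl. Qed.

Lemma qfB A B u : qf (A - B) u = qf A u - qf B u.
Proof. by rewrite /qf hopB rdotBl. Qed.

Lemma qfZ r A u : qf (r *: A) u = r * qf A u.
Proof. by rewrite /qf hopZ rdotZl. Qed.

Lemma qf_id u : qf (@id_op R E) u = hnorm u ^+ 2.
Proof. exact: rdotuu. Qed.

Lemma dotp_qf A u : dotp (A u) u = (qf A u)%:C.
Proof.
have := dotp_conj (A u) u; rewrite -hop_adj /qf /rdot.
case: (dotp (A u) u) => a b h; injection h => /eqP.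
by rewrite -addr_eq0 -mulr2n mulrn_eq0 /= => /eqP ->.
Qed.

Lemma positive_opP A : positive_op A <-> forall u, 0 <= qf A u.
Proof. by split=> Ap u; have := Ap u; rewrite dotp_qf ler0c. Qed.

Lemma le_opP A B : le_op A B <-> forall u, qf A u <= qf B u.
Proof.
rewrite /le_op; split=> [/positive_opP AB u|AB].
  by have := AB u; rewrite qfB subr_ge0.
by apply/positive_opP => u; rewrite qfB subr_ge0.
Qed.

Lemma cone_qf_ge0 (x : posCone E) u : 0 <= qf x u.
Proof. by move: u; apply/positive_opP; exact: cone_pos. Qed.

Lemma qf_abs_le A u : `|qf A u| <= opnorm A * hnorm u ^+ 2.
Proof.
rewrite (le_trans (rdot_abs_le _ _))// exprS expr1 mulrA.
by rewrite ler_wpM2r ?hnorm_ge0// opnorm_bound.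
Qed.

Lemma qf_le A u : qf A u <= opnorm A * hnorm u ^+ 2.
Proof. exact: le_trans (ler_norm _) (qf_abs_le _ _). Qed.

Lemma hopZC A (r : R) u : A (r%:C *: u) = r%:C *: A u.
Proof. by rewrite linearZ. Qed.

Lemma qf_sub A u v : qf A (u - v) = qf A u - 2 * rdot (A u) v + qf A v.
Proof.
rewrite /qf linearB rdotBl !rdotBr (rdot_hop A v u) (rdotC v); lra.
Qed.

Lemma qf_scale A r u : qf A (r%:C *: u) = r ^+ 2 * qf A u.
Proof. by rewrite /qf hopZC rdotZl rdotZr mulrA. Qed.

(* Polarization: [4 Re<Au, v> = <A(u+v), u+v> - <A(u-v), u-v>], then the
   parallelogram identity with [v] a multiple of [A u] of norm [|u|]. *)
Lemma opnorm_le_qf A (c : R) : 0 <= c ->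
  (forall u, `|qf A u| <= c * hnorm u ^+ 2) -> opnorm A <= c.
Proof.
move=> c0 Ac; apply: opnorm_le => // u.
have [Au0|Au0] := eqVneq (hnorm (A u)) 0.
  by rewrite Au0 mulr_ge0 ?hnorm_ge0.
have [u0|u0] := eqVneq (hnorm u) 0.
  by rewrite (hnorm_eq0 u0) linear0 hnorm0 mulr0.
have Au : 0 < hnorm (A u) by rewrite lt_neqAle eq_sym Au0 hnorm_ge0.
have uu : 0 < hnorm u by rewrite lt_neqAle eq_sym u0 hnorm_ge0.
set s := hnorm u / hnorm (A u).
have s0 : 0 < s by rewrite divr_gt0.
set v := s%:C *: A u.
have nv : hnorm v = hnorm u by rewrite Defs.hnormZ gtr0_norm// /s divfK.
have h1 : 4 * rdot (A u) v = qf A (u - - v) - qf A (u - v).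
  by rewrite !qf_sub rdotNr /qf linearN rdotNl rdotNr; lra.
have h2 : qf A (u - - v) - qf A (u - v) <=
    c * (hnorm (u - - v) ^+ 2 + hnorm (u - v) ^+ 2).
  have := Ac (u - - v); have := Ac (u - v); rewrite !ler_norml.
  by move=> /andP[? _] /andP[_ ?]; rewrite mulrDr; lra.
have h3 : hnorm (u - - v) ^+ 2 + hnorm (u - v) ^+ 2 = 4 * hnorm u ^+ 2.
  rewrite -!rdotuu !(rdotBl, rdotBr) !(rdotNl, rdotNr) (rdotC v u) !rdotuu nv.
  lra.
have h4 : rdot (A u) v = hnorm u * hnorm (A u).
  rewrite /v rdotZr rdotuu /s; field.
  by rewrite Au0.
move: h1 h2; rewrite h3 h4 => <-.
have -> : c * (4 * hnorm u ^+ 2) = 4 * (hnorm u * (c * hnorm u)) by ring.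
by rewrite ler_pM2l// ler_pM2l.
Qed.

(** This is [P^2 <= K P] for [0 <= P <= K]: positivity is tested at [u - K^-1 P u], and the upper
    bound absorbs the term in [P (P u)]. *)
Lemma herm_op_le_hnorm P (K : R) : 0 < K ->
  (forall u, 0 <= qf P u) -> (forall u, qf P u <= K * hnorm u ^+ 2) ->
  forall u, hnorm (P u) ^+ 2 <= K * qf P u.
Proof.
move=> K0 P0 PK u; have := P0 (u - K^-1%:C *: P u).
rewrite qf_sub rdotZr rdotuu qf_scale => h1.
have h2 := PK (P u).
have h3 : K^-1 ^+ 2 * qf P (P u) <= K^-1 * hnorm (P u) ^+ 2.
  rewrite exprS expr1 -mulrA ler_pM2l ?invr_gt0// ler_pdivrMl//.
have : 0 <= K * (qf P u - 2 * (K^-1 * hnorm (P u) ^+ 2) + K^-1 * hnorm (P u) ^+ 2).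
  by rewrite mulr_ge0 ?(ltW K0)//; lra.
have -> : K * (qf P u - 2 * (K^-1 * hnorm (P u) ^+ 2) + K^-1 * hnorm (P u) ^+ 2) =
  K * qf P u - hnorm (P u) ^+ 2 by field; rewrite gt_eqF.
by rewrite subr_ge0.
Qed.

(** A form version of positivity with bounded inverse: it passes to square roots and congruences,
    and a perturbation small in norm is small relative to the form. *)
Definition coercive A := exists2 m : R, 0 < m &
  forall u, m * hnorm u ^+ 2 <= qf A u.

Lemma coercive_ge0 A : coercive A -> forall u, 0 <= qf A u.
Proof.
by move=> [m m0 Am] u; rewrite (le_trans _ (Am u))// mulr_ge0 ?(ltW m0)//
  sqr_ge0.
Qed.

(** The bounded inverse bounds [|x u|] below by a multiple of [|u|], and [x^2 <= K x] carries this
    bound over to the form. *)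
Lemma posCone_coercive (x : posCone E) : coercive x.
Proof.
have [g [gb xg gx]] := cone_inv x.
have [N N0 gN] := bounded_ge0 gb.
have K0 : 0 < opnorm x + 1 by rewrite ltr_wpDl ?opnorm_ge0.
have N1 : 0 < 1 + N ^+ 2 by rewrite ltr_wpDr ?sqr_ge0.
exists ((opnorm x + 1)^-1 * (1 + N ^+ 2)^-1).
  by rewrite mulr_gt0 ?invr_gt0.
move=> u; rewrite -mulrA ler_pdivrMl// ler_pdivrMl// mulrC.
have h1 : hnorm (x u) ^+ 2 <= (opnorm x + 1) * qf x u.
  apply: herm_op_le_hnorm => // [v|v]; first exact: cone_qf_ge0.
  by rewrite (le_trans (qf_le _ _))// ler_wpM2r ?sqr_ge0// lerDl.
have h2 : hnorm u ^+ 2 <= N ^+ 2 * hnorm (x u) ^+ 2.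
  rewrite -exprMn lerXn2r ?nnegrE ?mulr_ge0 ?hnorm_ge0//.
  by rewrite -{1}(xg u) gN.
rewrite (le_trans h2)// mulrC ler_pM ?sqr_ge0//.
by rewrite lerDr.
Qed.

Lemma thompson_qf (x y : posCone E) u :
  qf x u <= expR (thompson x y) * qf y u.
Proof.
have gy : qf x u <= thompson_gauge x y * qf y u.
  have [c c0 yc] := posCone_coercive y.
  have ne : [set t | 0 < t /\ le_op x (t *: (y : hermOp E))] !=set0.
    exists ((opnorm x + 1) / c); split.
      by rewrite divr_gt0// ltr_wpDl ?opnorm_ge0.
    apply/le_opP => v; rewrite qfZ (le_trans (qf_le _ _))//.
    rewrite -mulrA ler_pM ?opnorm_ge0 ?sqr_ge0// ?lerDl//.
    by rewrite ler_pdivlMl.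
  have [y0|y0] := eqVneq (qf y u) 0.
    have [t [t0 /le_opP xy]] := ne.
    by have := xy u; rewrite qfZ y0 !mulr0.
  have yu : 0 < qf y u by rewrite lt_neqAle eq_sym y0 cone_qf_ge0.
  rewrite -ler_pdivrMr//; apply: lb_le_inf => //.
  by move=> t [t0 /le_opP /(_ u)]; rewrite qfZ ler_pdivrMr.
rewrite /thompson.
(* If the maximum is not positive, [ln] takes a default value; the gauge is then at most 0 and lies
   below any exponential. *)
have [m0|m0] := ltP 0 (Num.max (thompson_gauge x y) (thompson_gauge y x)).
  rewrite lnK// (le_trans gy)// ler_wpM2r ?cone_qf_ge0//.
  by rewrite le_max lexx.
rewrite (le_trans gy)// ler_wpM2r ?cone_qf_ge0//.
by rewrite (le_trans _ (expR_ge0 _))// (le_trans _ m0)// le_max lexx.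
Qed.

End quadratic_form.

(** * Completeness of the space of hermitian operators *)

Section hermOp_complete.
Context {R : realType} {E : hilbertType R}.
Local Open Scope complex_scope.

Lemma gt0_complex_real (e : R[i]) : 0 < e -> e = (complex.Re e)%:C.
Proof. by move=> e0; rewrite RRe_real// gtr0_real. Qed.

(** The radii of balls in [E] are elements of [R[i]]; positive ones are real, so real radii
    suffice. *)
Lemma cvg_hnormP T (F : set_system T) {FF : Filter F} (f : T -> E) (l : E) :
  f @ F --> l <->
  forall e : R, 0 < e -> \forall x \near F, hnorm (l - f x) < e.
Proof.
split=> [/cvgrPdist_lt fl e e0|fl].
  have e0' : 0 < e%:C :> R[i] by rewrite (ltcR 0).
  by apply: filterS (fl _ e0') => x; rewrite hnormE ltcR.
apply/cvgrPdist_lt => e e0; move: (e0); rewrite {1}(gt0_complex_real e0) (ltcR 0).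
move=> /fl; apply: filterS => x.
by rewrite hnormE {2}(gt0_complex_real e0) ltcR.
Qed.

Lemma hnorm_le_eq0 (u : E) (C : R) : 0 <= C ->
  (forall e : R, 0 < e -> hnorm u <= e * C) -> u = 0.
Proof.
move=> C0 h; apply: hnorm_eq0; apply/eqP; rewrite eq_le hnorm_ge0 andbT.
apply/ler_addgt0Pl => e e0; rewrite addr0.
have C1 : 0 < C + 1 by rewrite ltr_wpDl.
rewrite (le_trans (h (e / (C + 1)) _)) ?divr_gt0//.
by rewrite mulrAC ler_pdivrMr// ler_wpM2l ?lerDl// ltW.
Qed.

Section limit.
Variables (F : set_system (hermOp E)) (FF : ProperFilter F) (cF : cauchy F).

Let cauchyP (e : R) : 0 < e ->
  \forall A & B \near F, opnorm (A - B) < e.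
Proof.
by move=> e0; move/cauchy_ballP : cF => /(_ e e0); rewrite -ball_normE.
Qed.

Let cvg_pt (u : E) : cvg ((fun A : hermOp E => A u) @ F).
Proof.
apply: cauchy_cvg; apply/cauchy_ballP => e e0.
have {e0} [d d0 de] : exists2 d : R, 0 < d & e = d%:C.
  exists (complex.Re e); last exact: gt0_complex_real.
  by rewrite -(ltcR 0) -gt0_complex_real.
have d1 : 0 < d / (hnorm u + 1) by rewrite divr_gt0// ltr_wpDl ?hnorm_ge0.
rewrite near_map2.
have := cauchyP d1; apply: filterS => -[A B] /= AB.
rewrite -ball_normE /= de hnormE ltcR -hopB (le_lt_trans (opnorm_bound _ _))//.
rewrite -[ltRHS](@divfK _ (hnorm u + 1)) ?gt_eqF// ?ltr_wpDl ?hnorm_ge0//.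
rewrite (@le_lt_trans _ _ (d / (hnorm u + 1) * hnorm u))//.
  by rewrite ler_wpM2r ?hnorm_ge0// ltW.
by rewrite ltr_pM2l// ltrDl.
Qed.

Let Lf (u : E) : E := lim ((fun A : hermOp E => A u) @ F).

(** The Cauchy bound on [A - B] is uniform in [u], and it stays so when [B u] tends to [Lf u]. The
    properties of the limit then follow by comparison with a single [A]. *)
Let near_Lf (e : R) : 0 < e ->
  \forall A \near F, forall u, hnorm ((A : hermOp E) u - Lf u) <= e * hnorm u.
Proof.
move=> e0; have /nearP_dep := cauchyP e0; apply: filterS => A AB u.
apply/ler_addgt0Pl => d d0.
have ptu : (fun B : hermOp E => B u) @ F --> Lf u by exact: cvg_pt.
have /cvg_hnormP/(_ _ d0) hd := ptu.
have [B [h1 h2]] := filter_ex (filterI AB hd).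
have -> : A u - Lf u = (A - B) u - (Lf u - B u).
  by rewrite hopB opprB addrA subrK.
rewrite (le_trans (Defs.hnormD _ _))// hnormN addrC lerD//; first exact: ltW.
by rewrite (le_trans (opnorm_bound _ _))// ler_wpM2r ?hnorm_ge0// ltW.
Qed.

Let near_Lf_rdot (e : R) : 0 < e ->
  \forall A \near F, forall u v,
    `|rdot ((A : hermOp E) u - Lf u) v| <= e * (hnorm u * hnorm v).
Proof.
move=> /near_Lf; apply: filterS => A AL u v.
by rewrite (le_trans (rdot_abs_le _ _))// mulrA ler_wpM2r ?hnorm_ge0.
Qed.

Let Lf_linear : linear Lf.
Proof.
move=> a u v.
apply/eqP; rewrite -subr_eq0; apply/eqP.
apply: (@hnorm_le_eq0 _ (complex.Re `|a| * hnorm u + hnorm v + hnorm (a *: u + v))).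
  rewrite !addr_ge0 ?mulr_ge0 ?hnorm_ge0//.
  by rewrite -ler0c RRe_real ?normr_real.
move=> e e0; have [A AL] := filter_ex (near_Lf e0).
have -> : Lf (a *: u + v) - (a *: Lf u + Lf v) =
   a *: (A u - Lf u) + (A v - Lf v) - (A (a *: u + v) - Lf (a *: u + v)).
  by rewrite (hop_linear A) scalerBr opprB [in RHS](addrACA (a *: A u)) -opprD
    [RHS]addrC addrA subrK.
rewrite (le_trans (Defs.hnormD _ _))// hnormN mulrDr lerD//.
rewrite (le_trans (Defs.hnormD _ _))// mulrDr lerD//.
rewrite mulrCA.
have -> : hnorm (a *: (A u - Lf u)) = complex.Re `|a| * hnorm (A u - Lf u).
  apply: complexI; rewrite rmorphM /= RRe_real ?normr_real//.
  by rewrite -!hnormE normrZ.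
by rewrite ler_wpM2l// -ler0c RRe_real ?normr_real.
Qed.

Let Lf_bounded : bounded_operator Lf.
Proof.
split; first exact: Lf_linear.
have [A AL] := filter_ex (near_Lf (@ltr01 R)).
exists (opnorm A + 1) => u.
have -> : Lf u = A u - (A u - Lf u) by rewrite subKr.
by rewrite (le_trans (Defs.hnormD _ _))// hnormN mulrDl lerD// opnorm_bound.
Qed.

Let Lf_adj : self_adjoint Lf.
Proof.
apply: rdot_self_adjoint; first exact: Lf_linear.
move=> u v; apply/eqP; rewrite -subr_eq0 -normr_eq0 eq_le normr_ge0 andbT.
apply/ler_addgt0Pl => d d0; rewrite addr0.
have C0 : 0 < 2 * (hnorm u * hnorm v) + 1.
  by rewrite ltr_wpDl// mulr_ge0// mulr_ge0 ?hnorm_ge0.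
have [A AL] := filter_ex (near_Lf_rdot (divr_gt0 d0 C0)).
have -> : rdot (Lf u) v - rdot u (Lf v) =
    rdot (A v - Lf v) u - rdot (A u - Lf u) v.
  by rewrite !rdotBl (rdot_hop A v u) (rdotC v) (rdotC u); lra.
rewrite (le_trans (ler_normB _ _))//.
have := AL v u; have := AL u v; rewrite (mulrC (hnorm v)).
move=> h1 h2; rewrite (le_trans (lerD h2 h1))// -mulrDr.
by rewrite mulrAC ler_pdivrMr// ler_wpM2l ?(ltW d0)//; lra.
Qed.

Let Lop := HermOp Lf_bounded Lf_adj.

(** Completeness gives the convergence of the exponential series and the fixpoints of
    contractions. *)
Fact hermOp_cauchy_cvg : cvg F.
Proof.
apply/cvg_ex; exists Lop; apply/cvgrPdist_le => e e0.
apply: filterS (near_Lf e0) => A AL.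
rewrite -opprB normrN opnormE; apply: opnorm_le; first exact: ltW.
by move=> u; rewrite hopB AL.
Qed.

End limit.

HB.instance Definition _ := Uniform_isComplete.Build (hermOp E)
  hermOp_cauchy_cvg.

End hermOp_complete.

(** * Operator square roots *)

Lemma closed_norm_le {R : realType} (V : normedModType R) (r : R) :
  closed [set x : V | `|x| <= r].
Proof.
have -> : [set x : V | `|x| <= r] =
  (fun x : V => `|x|) @^-1` [set y | y <= r] by [].
apply: closed_comp; last exact: closed_le.
by move=> x _; exact: norm_continuous.
Qed.

(** Serves twice: for the square root of an operator and for the inversion of the exponential near
    the identity. *)
Lemma fixpoint_ball {R : realType} {V : completeNormedModType R} (f : V -> V)
    (r q : R) : 0 <= r -> 0 <= q -> q < 1 ->
  (forall x, `|x| <= r -> `|f x| <= r) ->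
  (forall x y, `|x| <= r -> `|y| <= r -> `|f x - f y| <= q * `|x - y|) ->
  exists2 x, `|x| <= r & f x = x.
Proof.
move=> r0 q0 q1 fr fq; pose U : set V := [set x | `|x| <= r].
have ff : set_fun U U f by move=> x; exact: fr.
pose g : {fun U >-> U} := HB.pack f (isFun.Build _ _ U U f ff).
have gc : is_contraction g.
  exists (NngNum q0); split => // -[x y] [/= xU yU]; exact: fq.
have cU : closed U by exact: closed_norm_le.
have [|x xU xE] := banach_fixed_point gc cU.
  by exists 0; rewrite /U /= normr0.
by exists x.
Qed.

Section square_root.
Context {R : realType} {E : hilbertType R}.
Implicit Types (u v w : E) (r : R) (A B S T P : hermOp E).
Local Open Scope complex_scope.

(* If [c] is the least constant with [S <= T + c], then [w := (T - S + c) u] is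
   small for some unit [u], where [S u + w = T u + c u]; taking norms yields
   [c = 0]. *)
Lemma hnorm_le_qf_le S T :
  (forall u, 0 <= qf T u) ->
  (forall u, hnorm (S u) <= hnorm (T u)) ->
  forall u, qf S u <= qf T u.
Proof.
move=> T0 ST.
pose G : set R := [set c | 0 <= c /\ forall u, qf S u <= qf T u + c * hnorm u ^+ 2].
have G0 : G !=set0.
  exists (opnorm S); split; first exact: opnorm_ge0.
  by move=> u; rewrite (le_trans (qf_le _ _))// lerDr.
have Glb : has_lbound G by exists 0 => c [].
pose c := inf G.
have c0 : 0 <= c by apply: lb_le_inf => // t [].
have Gc u : qf S u <= qf T u + c * hnorm u ^+ 2.
  have [u0|u0] := eqVneq (hnorm u) 0.
    by rewrite (hnorm_eq0 u0) /qf !linear0 /rdot dotp0l hnorm0 expr0n mulr0 addr0.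
  have uu : 0 < hnorm u ^+ 2 by rewrite exprn_gt0// lt_neqAle eq_sym u0 hnorm_ge0.
  rewrite -lerBlDl -ler_pdivrMr//; apply: lb_le_inf => // t [_ /(_ u)].
  by rewrite ler_pdivrMr// lerBlDl.
have [c_eq0|cn0] := eqVneq c 0.
  by move=> u; have := Gc u; rewrite c_eq0 mul0r addr0.
have {cn0} c_gt0 : 0 < c by rewrite lt_neqAle eq_sym cn0.
exfalso.
pose P := T - S + c *: (id_op : hermOp E).
have qP u : qf P u = qf T u - qf S u + c * hnorm u ^+ 2.
  by rewrite qfD qfB qfZ qf_id.
have P0 u : 0 <= qf P u by rewrite qP; have := Gc u; lra.
pose K := opnorm P + 1.
have K0 : 0 < K by rewrite ltr_wpDl ?opnorm_ge0.
have PK u : hnorm (P u) <= K * hnorm u.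
  by rewrite (le_trans (opnorm_bound _ _))// ler_wpM2r ?hnorm_ge0// lerDl.
have PK2 : forall u, hnorm (P u) ^+ 2 <= K * qf P u.
  apply: herm_op_le_hnorm => // u.
  by rewrite (le_trans (qf_le _ _))// ler_wpM2r ?sqr_ge0// lerDl.
pose C := 2 * opnorm S + K.
have C0 : 0 < C by rewrite ltr_wpDl// mulr_ge0// opnorm_ge0.
have key u : c ^+ 2 * hnorm u <= C * hnorm (P u).
  have [u0|u0] := eqVneq (hnorm u) 0.
    by rewrite u0 mulr0 mulr_ge0 ?hnorm_ge0// ltW.
  have uu : 0 < hnorm u by rewrite lt_neqAle eq_sym u0 hnorm_ge0.
  have e1 : hnorm (S u + P u) ^+ 2 =
      hnorm (T u) ^+ 2 + 2 * c * qf T u + c ^+ 2 * hnorm u ^+ 2.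
    have -> : S u + P u = T u + c%:C *: u.
      by rewrite hopD hopB hopZ /= addrA addrCA subrr addr0.
    rewrite hnorm_sqrD rdotZr Defs.hnormZ (gtr0_norm c_gt0) /qf exprMn; ring.
  have e2 : hnorm (S u + P u) ^+ 2 =
      hnorm (S u) ^+ 2 + 2 * rdot (S u) (P u) + hnorm (P u) ^+ 2.
    exact: hnorm_sqrD.
  have e3 : hnorm (S u) ^+ 2 <= hnorm (T u) ^+ 2.
    by rewrite lerXn2r ?nnegrE ?hnorm_ge0.
  have e4 : rdot (S u) (P u) <= opnorm S * hnorm u * hnorm (P u).
    rewrite (le_trans (rdot_le _ _))// ler_wpM2r ?hnorm_ge0//.
    exact: opnorm_bound.
  have e5 : hnorm (P u) ^+ 2 <= K * hnorm u * hnorm (P u).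
    by rewrite exprS expr1 ler_wpM2r ?hnorm_ge0.
  have e6 : 0 <= 2 * c * qf T u by rewrite !mulr_ge0.
  rewrite -(ler_pM2l uu) /C.
  have -> : hnorm u * (c ^+ 2 * hnorm u) = c ^+ 2 * hnorm u ^+ 2 by ring.
  have -> : hnorm u * ((2 * opnorm S + K) * hnorm (P u)) =
   2 * (opnorm S * hnorm u * hnorm (P u)) + K * hnorm u * hnorm (P u) by ring.
  lra.
(* Squaring [key] and applying [PK2] gives [c^4 |u|^2 <= C^2 K qf P u]. So [P] is bounded below by
   [d], and [c] can be lowered by [min d c], which keeps it nonnegative, against its minimality. *)
pose d := c ^+ 4 / (C ^+ 2 * K).
have d0 : 0 < d by rewrite divr_gt0 ?mulr_gt0 ?exprn_gt0.
have Pd u : d * hnorm u ^+ 2 <= qf P u.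
  have h : (c ^+ 2 * hnorm u) ^+ 2 <= (C * hnorm (P u)) ^+ 2.
    by rewrite lerXn2r ?nnegrE ?mulr_ge0 ?hnorm_ge0 ?sqr_ge0 ?(ltW C0).
  rewrite /d mulrAC ler_pdivrMr ?mulr_gt0 ?exprn_gt0//.
  have -> : c ^+ 4 * hnorm u ^+ 2 = (c ^+ 2 * hnorm u) ^+ 2 by ring.
  rewrite (le_trans h)// exprMn.
  have -> : qf P u * (C ^+ 2 * K) = C ^+ 2 * (K * qf P u) by ring.
  by rewrite ler_wpM2l ?sqr_ge0.
pose e := Num.min d c.
have e0 : 0 < e by rewrite lt_min d0.
have : G (c - e).
  split; first by rewrite subr_ge0 ge_min lexx orbT.
  move=> u; have := Pd u; rewrite qP.
  have : e * hnorm u ^+ 2 <= d * hnorm u ^+ 2.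
    by rewrite ler_wpM2r ?sqr_ge0// ge_min lexx.
  by rewrite mulrBl; lra.
move=> /(ge_inf Glb); rewrite -/c; lra.
Qed.

Lemma hnorm_sqr_qf A B u : (forall v, A (A v) = B v) -> hnorm (A u) ^+ 2 = qf B u.
Proof. by move=> AB; rewrite -rdotuu rdot_hop AB rdotC. Qed.

(** The inequality [S^2 <= T^2] between forms says that [|S u| <= |T u|]. *)
Lemma sqrt_mono A B S T : (forall u, 0 <= qf T u) ->
  (forall u, S (S u) = A u) -> (forall u, T (T u) = B u) ->
  (forall u, qf A u <= qf B u) -> forall u, qf S u <= qf T u.
Proof.
move=> T0 SA TB AB; apply: hnorm_le_qf_le => // u.
rewrite -(@ler_pXn2r _ 2) ?nnegrE ?hnorm_ge0//.
by rewrite (hnorm_sqr_qf _ SA) (hnorm_sqr_qf _ TB).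
Qed.

Lemma pow2_diff A B : `|pow_op A 2 - pow_op B 2| <= (`|A| + `|B|) * `|A - B|.
Proof.
rewrite !opnormE; apply: opnorm_le.
  by rewrite mulr_ge0 ?addr_ge0 ?opnorm_ge0.
move=> u; have -> : (pow_op A 2 - pow_op B 2) u = A ((A - B) u) + (A - B) (B u).
  by rewrite !hopB /= linearB addrA subrK.
rewrite (le_trans (Defs.hnormD _ _))// mulrDl mulrDl lerD//.
  rewrite (le_trans (opnorm_bound _ _))// -mulrA ler_wpM2l ?opnorm_ge0//.
  exact: opnorm_bound.
rewrite (le_trans (opnorm_bound _ _))// [X in _ <= X * _]mulrC -mulrA.
by rewrite ler_wpM2l ?opnorm_ge0// opnorm_bound.
Qed.

(* For [A = c (1 - T)] with [|T| < 1], the root is [sqrt c (1 - Y)] where [Y] is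
   the fixpoint of the contraction [Y |-> (Y^2 + T) / 2]. *)
Lemma coercive_sqrt A : coercive A ->
  exists2 S, coercive S & forall u, S (S u) = A u.
Proof.
move=> [m m0 Am].
(* From [m <= A <= c] one gets [0 <= T <= rho < 1] for [T = 1 - c^-1 A]. *)
pose c := opnorm A + m.
have c0 : 0 < c by rewrite ltr_wpDl ?opnorm_ge0.
pose rho := 1 - m / c.
have rho1 : rho < 1 by rewrite gtrBl divr_gt0.
have rho0 : 0 <= rho by rewrite subr_ge0 ler_pdivrMr// mul1r lerDr opnorm_ge0.
pose T : hermOp E := (id_op : hermOp E) - c^-1 *: A.
have qT u : qf T u = hnorm u ^+ 2 - c^-1 * qf A u by rewrite qfB qfZ qf_id.
have T_rho : `|T| <= rho.
  rewrite opnormE; apply: opnorm_le_qf => // u; rewrite ger0_norm qT.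
    rewrite mulrBl mul1r lerD2l lerN2 mulrAC [leRHS]mulrC.
    by rewrite ler_wpM2r ?invr_ge0 ?(ltW c0).
  rewrite subr_ge0 ler_pdivrMl// (le_trans (qf_le _ _))// ler_wpM2r ?sqr_ge0//.
  by rewrite lerDl ltW.
(* The radius [q = 1 - s] is the smaller root of [(q^2 + rho) / 2 = q]: the map preserves the ball
   of radius [q], and [q] is also its Lipschitz constant there. *)
pose s := Num.sqrt (1 - rho).
have s0 : 0 < s by rewrite sqrtr_gt0 subr_gt0.
have s1 : s <= 1 by rewrite -sqrtr1 ler_wsqrtr// gerBl.
have ss : s ^+ 2 = 1 - rho by rewrite sqr_sqrtr// subr_ge0 ltW.
pose q := 1 - s.
have q0 : 0 <= q by rewrite subr_ge0.
have q1 : q < 1 by rewrite gtrBl.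
pose f (Y : hermOp E) : hermOp E := 2^-1 *: (pow_op Y 2 + T).
have pow2_0 : pow_op (0 : hermOp E) 2 = 0.
  by apply: hermOp_ext => u.
have pow2_le (Y : hermOp E) : `|Y| <= q -> `|pow_op Y 2| <= q ^+ 2.
  move=> Yq; have := pow2_diff Y 0; rewrite pow2_0 !subr0 normr0 addr0.
  move=> /le_trans; apply; rewrite -expr2 lerXn2r ?nnegrE//.
have [||Y Yq fY] := @fixpoint_ball R (hermOp E) f q q q0 q0 q1.
- move=> Y Yq; rewrite /f normrZ ger0_norm ?invr_ge0// ler_pdivrMl//.
  rewrite (le_trans (ler_normD _ _))//.
  have qq : q ^+ 2 = 1 - 2 * s + s ^+ 2 by rewrite /q; ring.
  by have := pow2_le _ Yq; rewrite qq ss /q; lra.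
- move=> Y Z Yq Zq; rewrite /f -scalerBr normrZ ger0_norm ?invr_ge0//.
  rewrite opprD addrACA subrr addr0 ler_pdivrMl//.
  rewrite (le_trans (pow2_diff _ _))// mulrA ler_wpM2r// mulr_natl mulr2n.
  by rewrite lerD.
have YE u : Y (Y u) = Y u + Y u - T u.
  have YY : pow_op Y 2 + T = Y + Y.
    have h2 : 2^-1 + 2^-1 = 1 :> R by field.
    by rewrite -{2 3}fY /f -scalerDl h2 scale1r.
  by have /(congr1 (fun Z : hermOp E => Z u)) := YY; rewrite !hopD /= => <-;
    rewrite addrK.
pose S0 : hermOp E := (id_op : hermOp E) - Y.
have S0E u : S0 (S0 u) = c^-1%:C *: A u.
  have zz (a b t : E) : a - b - (b - (b + b - t)) = a - t.
    by rewrite (opprB b) (addrC (b + b - t)) -(addrA b) addKr addrA subrK.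
  rewrite /S0 !hopB /= linearB /= YE zz /T hopB hopZ /=.
  by rewrite opprB addrCA subrr addr0.
have S0_ge u : (1 - q) * hnorm u ^+ 2 <= qf S0 u.
  rewrite qfB qf_id mulrBl mul1r lerD2l lerN2 (le_trans (qf_le _ _))//.
  by rewrite ler_wpM2r ?sqr_ge0.
exists (Num.sqrt c *: S0).
  exists (Num.sqrt c * (1 - q)); first by rewrite mulr_gt0 ?sqrtr_gt0 ?subr_gt0.
  by move=> u; rewrite qfZ -mulrA ler_wpM2l ?sqrtr_ge0.
move=> u; rewrite !hopZ hopZC scalerA S0E scalerA -!rmorphM /= -expr2.
by rewrite sqr_sqrtr ?(ltW c0)// mulfV ?gt_eqF// scale1r.
Qed.

End square_root.

(** * The operator exponential *)

(** The coefficient of degree [n] in [exp X * exp X = exp (2 X)], by the binomial formula for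
    [1 + 1]. *)
Lemma sum_invfact_conv {R : realType} (n : nat) :
  \sum_(i < n.+1) (i`!%:R^-1 * (n - i)`!%:R^-1) = 2 ^+ n / n`!%:R :> R.
Proof.
have nf k : k`!%:R != 0 :> R by rewrite pnatr_eq0 -lt0n fact_gt0.
have -> : (2 : R) = 1 + 1 by [].
rewrite exprDn mulr_suml; apply: eq_bigr => i _.
rewrite !expr1n mulr1.
have le_in : (i <= n)%N by rewrite -ltnS.
rewrite -(bin_fact le_in) !natrM; field.
by rewrite !nf /= pnatr_eq0 -lt0n bin_gt0.
Qed.

(** * Polynomials in one hermitian operator *)

Section operator_polynomial.
Context {R : realType} {E : hilbertType R}.
Implicit Types (u v w : E) (A B : hermOp E) (p q : {poly R}).
Local Open Scope complex_scope.

(** A composite of hermitian operators may fail to be hermitian, so [hermOp E] carries no product;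
    polynomials in a single operator stay hermitian, and their products are compared on vectors. *)
Definition poly_op p A : hermOp E := \sum_(i < size p) p`_i *: pow_op A i.

Lemma poly_op_wide p A n : (size p <= n)%N ->
  poly_op p A = \sum_(i < n) p`_i *: pow_op A i.
Proof.
move=> pn; rewrite /poly_op (big_ord_widen n (fun i => p`_i *: pow_op A i) pn).
rewrite big_mkcond; apply: eq_bigr => i _; case: ltnP => // ip.
by rewrite nth_default// scale0r.
Qed.

Lemma poly_opD p q A : poly_op (p + q) A = poly_op p A + poly_op q A.
Proof.
pose n := maxn (size p) (size q).
rewrite !(@poly_op_wide _ _ n) ?leq_maxl ?leq_maxr ?size_polyD// -big_split /=.
by apply: eq_bigr => i _; rewrite coefD scalerDl.
Qed.

Lemma poly_opZ c p A : poly_op (c *: p) A = c *: poly_op p A.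
Proof.
rewrite !(@poly_op_wide _ _ (size p)) ?size_scale_leq// scaler_sumr.
by apply: eq_bigr => i _; rewrite coefZ scalerA.
Qed.

Lemma poly_opB p q A : poly_op (p - q) A = poly_op p A - poly_op q A.
Proof. by rewrite poly_opD -scaleN1r poly_opZ scaleN1r. Qed.

Lemma poly_opC c A u : poly_op c%:P A u = c%:C *: u.
Proof.
rewrite (@poly_op_wide _ _ 1) ?size_polyC_leq1// big_ord_recl big_ord0 addr0.
by rewrite coefC eqxx hopZ.
Qed.

Lemma hop_sum n (F : 'I_n -> hermOp E) u : (\sum_i F i) u = \sum_i F i u.
Proof.
elim: n F => [|n IHn] F; first by rewrite !big_ord0.
by rewrite !big_ord_recl hopD IHn.
Qed.

Lemma hop_sumr A n (f : 'I_n -> E) : A (\sum_i f i) = \sum_i A (f i).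
Proof. exact: linear_sum. Qed.

Lemma poly_opMX p A u : poly_op (p * 'X) A u = A (poly_op p A u).
Proof.
have [->|p0] := eqVneq p 0.
  by rewrite mul0r /poly_op size_poly0 big_ord0 linear0.
rewrite /poly_op size_mulX// big_ord_recl coefMX eqxx scale0r add0r !hop_sum.
rewrite hop_sumr; apply: eq_bigr => i _.
by rewrite !hopZ hopZC coefMX.
Qed.

Lemma poly_opM p q A u : poly_op (p * q) A u = poly_op p A (poly_op q A u).
Proof.
elim/poly_ind: p u => [|p c IHp] u.
  by rewrite mul0r /poly_op size_poly0 big_ord0.
rewrite mulrDl poly_opD hopD -mulrA (mulrC 'X) mulrA poly_opMX IHp.
rewrite poly_opD hopD poly_opMX; congr (_ + _).
by rewrite mul_polyC poly_opZ poly_opC hopZ.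
Qed.

Lemma opnorm_pow A n : `|pow_op A n| <= `|A| ^+ n.
Proof.
rewrite !opnormE; apply: opnorm_le; first by rewrite exprn_ge0 ?opnorm_ge0.
move=> u; elim: n => [|n IHn]; first by rewrite expr0 mul1r.
rewrite /= (le_trans (opnorm_bound _ _))// exprS -mulrA.
by rewrite ler_wpM2l ?opnorm_ge0.
Qed.

Lemma poly_op_norm_le p A : (forall i, 0 <= p`_i) -> `|poly_op p A| <= p.[`|A|].
Proof.
move=> p0; rewrite horner_coef (le_trans (ler_norm_sum _ _ _))//.
apply: ler_sum => i _; rewrite normrZ ger0_norm// ler_wpM2l//.
exact: opnorm_pow.
Qed.

Lemma pow_opZ (c : R) A n : pow_op (c *: A) n = c ^+ n *: pow_op A n.
Proof.
apply: hermOp_ext => u; elim: n => [|n IHn]; first by rewrite hopZ /= scale1r.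
by rewrite -[LHS]/((c *: A) (pow_op (c *: A) n u)) IHn !hopZ hopZC scalerA
  -rmorphM -exprS.
Qed.

(** Telescoping by [A^(n+1) - B^(n+1) = A (A^n - B^n) + (A - B) B^n], valid for operators that do
    not commute. *)
Lemma pow_op_diff A B (q : R) n : 0 <= q -> `|A| <= q -> `|B| <= q ->
  `|pow_op A n.+1 - pow_op B n.+1| <= n.+1%:R * q ^+ n * `|A - B|.
Proof.
move=> q0 Aq Bq; rewrite !opnormE; apply: opnorm_le.
  by rewrite !mulr_ge0 ?exprn_ge0 ?opnorm_ge0.
elim: n => [|n IHn] u; first by rewrite expr0 !mulr1 mul1r; exact: opnorm_bound.
have -> : (pow_op A n.+2 - pow_op B n.+2) u =
    A ((pow_op A n.+1 - pow_op B n.+1) u) + (A - B) (pow_op B n.+1 u).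
  by rewrite !hopB linearB addrA subrK.
rewrite (le_trans (Defs.hnormD _ _))//.
have -> : n.+2%:R * q ^+ n.+1 * opnorm (A - B) * hnorm u =
  q * (n.+1%:R * q ^+ n * opnorm (A - B) * hnorm u) +
  opnorm (A - B) * (q ^+ n.+1 * hnorm u).
  by rewrite -(addn1 n.+1) natrD exprS; ring.
rewrite lerD//.
  rewrite (le_trans (opnorm_bound _ _))// ler_pM ?opnorm_ge0 ?hnorm_ge0//.
rewrite (le_trans (opnorm_bound _ _))// ler_wpM2l ?opnorm_ge0//.
rewrite (le_trans (opnorm_bound _ _))// ler_wpM2r ?hnorm_ge0//.
by rewrite -opnormE (le_trans (opnorm_pow _ _))// lerXn2r ?nnegrE.
Qed.

End operator_polynomial.

Section operator_exponential.
Context {R : realType} {E : hilbertType R}.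
Implicit Types (u v w : E) (A B : hermOp E).
Local Open Scope complex_scope.

Definition exp_sum A : nat -> hermOp E :=
  series (fun n => (n`!%:R)^-1 *: pow_op A n).

Lemma cvg_exp_sum A : exp_sum A n @[n --> \oo] --> exp_op A.
Proof.
suff : cvgn (exp_sum A) by [].
apply: normed_cvg; apply: series_le_cvg (is_cvg_series_exp_coeff `|A|) => n.
- exact: normr_ge0.
- by rewrite /exp_coeff divr_ge0 ?exprn_ge0.
- rewrite /= /exp_coeff /= mulrC normrZ ger0_norm ?invr_ge0// ler_wpM2l ?invr_ge0//.
  exact: opnorm_pow.
Qed.

Lemma exp_op0 : exp_op (0 : hermOp E) = id_op.
Proof.
apply: (@cvg_unique _ (@norm_hausdorff _ _) _ _ _ _ (@cvg_exp_sum 0)).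
apply: cvg_near_cst; exists 1%N => // -[//|n] _.
rewrite /exp_sum /series /= big_nat_recl// big1 ?addr0.
  by rewrite fact0 invr1 scale1r; exact: hermOp_ext.
move=> i _; have -> : pow_op (0 : hermOp E) i.+1 = 0 by exact: hermOp_ext.
by rewrite scaler0.
Qed.

(** Degrees 0 and 1 cancel against [A - B]. Degree [k >= 2] contributes at most
    [k q^(k-1) / k! <= q^(k-1)] times [|A - B|], and these powers sum to [q / (1 - q)]. *)
Lemma exp_op_diff A B (q : R) : 0 <= q -> q < 1 -> `|A| <= q -> `|B| <= q ->
  `|exp_op A - exp_op B - (A - B)| <= q / (1 - q) * `|A - B|.
Proof.
move=> q0 q1 Aq Bq.
have q2 : 0 < 1 - q by rewrite subr_gt0.
pose f n := exp_sum A n - exp_sum B n - (A - B).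
have fcvg : f n @[n --> \oo] --> exp_op A - exp_op B - (A - B).
  by apply: cvgB; [apply: cvgB; exact: cvg_exp_sum|exact: cvg_cst].
pose D : set (hermOp E) := [set x | `|x| <= q / (1 - q) * `|A - B|].
suff: D (exp_op A - exp_op B - (A - B)) by [].
apply: (closed_cvg D _ _ _ fcvg); first exact: closed_norm_le.
suff fn n : `|f n.+2| <= q / (1 - q) * (1 - q ^+ n) * `|A - B|.
  exists 2%N => // -[|[|n]] //= _.
  apply: (le_trans (fn n)); rewrite ler_wpM2r// ler_piMr ?divr_ge0 ?(ltW q2)//.
  by rewrite gerBl exprn_ge0.
have zz (x a y b z : hermOp E) : x + a - (y + b) - z = x - y - z + (a - b).
  by rewrite (opprD y) addrACA (addrAC (x - y)).
elim: n => [|n IHn].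
  rewrite expr0 subrr mulr0 mul0r normr_le0 /f /exp_sum /series /=.
  rewrite !big_nat_recr//= !big_nil !add0r !factS !fact0 !muln1 !invr1 !scale1r.
  have pow1 (C : hermOp E) : pow_op C 1 = C by exact: hermOp_ext.
  have -> : pow_op A 0 = pow_op B 0 by exact: hermOp_ext.
  by rewrite zz !pow1 subrr add0r addNr.
have -> : f n.+3 = f n.+2 + (n.+2`!%:R)^-1 *: (pow_op A n.+2 - pow_op B n.+2).
  rewrite /f /exp_sum /series /= !(big_nat_recr n.+2)//= scalerBr.
  exact: zz.
rewrite (le_trans (ler_normD _ _))//.
have -> : q / (1 - q) * (1 - q ^+ n.+1) * `|A - B| =
  q / (1 - q) * (1 - q ^+ n) * `|A - B| + q ^+ n.+1 * `|A - B|.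
  by rewrite exprS; field; rewrite gt_eqF.
rewrite lerD// normrZ ger0_norm ?invr_ge0// ler_pdivrMl ?ltr0n ?fact_gt0//.
rewrite (le_trans (pow_op_diff _ q0 Aq Bq))// mulrA ler_wpM2r//.
rewrite ler_wpM2r ?exprn_ge0// ler_nat factS.
by rewrite leq_pmulr// fact_gt0.
Qed.

Lemma exp_op_small A (q : R) : 0 <= q -> q < 1 -> `|A| <= q ->
  `|exp_op A - id_op - A| <= q / (1 - q) * `|A|.
Proof.
move=> q0 q1 Aq; have := @exp_op_diff A 0 q q0 q1 Aq.
by rewrite normr0 exp_op0 !subr0; exact.
Qed.

Lemma cvg_pow2 (X : nat -> hermOp E) A : X n @[n --> \oo] --> A ->
  pow_op (X n) 2 @[n --> \oo] --> pow_op A 2.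
Proof.
move=> XA; apply/cvgrPdist_le => e e0.
have h : (`|X n| + `|A|) * `|A - X n| @[n --> \oo] --> (0 : R).
  rewrite -[0 : R](mulr0 (`|A| + `|A|)).
  apply: cvgM; first by apply: cvgD; [exact: cvg_norm|exact: cvg_cst].
  rewrite -(@normr0 _ (hermOp E)) -(subrr A).
  by apply: cvg_norm; apply: cvgB => //; exact: cvg_cst.
move/cvgrPdist_le : h => /(_ _ e0); apply: filterS => n.
rewrite sub0r normrN ger0_norm ?mulr_ge0 ?addr_ge0//; apply: le_trans.
by rewrite (addrC `|X n|) pow2_diff.
Qed.

(* With [e_N] the partial sums of the exponential series, the polynomial
   [e_2N(2X) - e_N(X)^2] has nonnegative coefficients, so that its value at [A]
   is bounded by its value at [|A|], which tends to [0]. *)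
Lemma exp_op_double A u : exp_op (2 *: A) u = exp_op A (exp_op A u).
Proof.
suff -> : exp_op (2 *: A) = pow_op (exp_op A) 2 by [].
pose e N : {poly R} := \poly_(i < N) (i`!%:R)^-1.
pose e2 N : {poly R} := \poly_(i < N) (2 ^+ i / i`!%:R).
have sumE N : exp_sum A N = poly_op (e N) A.
  rewrite (@poly_op_wide _ _ _ _ N) ?size_poly// /exp_sum /series /= big_mkord.
  by apply: eq_bigr => i _; rewrite coef_poly ltn_ord.
have sum2E N : exp_sum (2 *: A) N = poly_op (e2 N) A.
  rewrite (@poly_op_wide _ _ _ _ N) ?size_poly// /exp_sum /series /= big_mkord.
  by apply: eq_bigr => i _; rewrite coef_poly ltn_ord pow_opZ scalerA mulrC.
pose a := `|A|.
have eE N (x : R) : (e N).[x] = series (exp_coeff x) N.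
  rewrite horner_poly /series /= big_mkord; apply: eq_bigr => i _.
  by rewrite /exp_coeff /= mulrC.
have e2E N (x : R) : (e2 N).[x] = series (exp_coeff (2 * x)) N.
  rewrite horner_poly /series /= big_mkord; apply: eq_bigr => i _.
  by rewrite /exp_coeff /= exprMn mulrAC.
have pow2E N : pow_op (exp_sum A N) 2 = poly_op (e N * e N) A.
  by apply: hermOp_ext => v; rewrite poly_opM /= sumE.
have e_ge0 N i : 0 <= (e N)`_i by rewrite coef_poly; case: ifP.
have D_ge0 N i : 0 <= (e2 (N + N)%N - e N * e N)`_i.
  rewrite coefB coefM subr_ge0 coef_poly; case: ltnP => iN.
    rewrite -sum_invfact_conv; apply: ler_sum => j _.
    have le_e k : (e N)`_k <= (k`!%:R)^-1.
      by rewrite coef_poly; case: ifP => // _; rewrite invr_ge0.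
    by rewrite ler_pM.
  (* In degree at least [2N], each product has a factor of degree at least [N], whose coefficient is
     0. *)
  rewrite big1// => j _; rewrite !coef_poly.
  case: ltnP => jN; last by rewrite mul0r.
  rewrite ltnNge.
  have -> : (N <= i - j)%N.
    by rewrite leq_subRL ?(leq_trans (ltnW jN)) ?(leq_trans _ iN) ?leq_add2r
      ?leq_addl// ltnW.
  by rewrite mulr0.
have bound N : `|exp_sum (2 *: A) (N + N)%N - pow_op (exp_sum A N) 2| <=
    series (exp_coeff (2 * a)) (N + N)%N - series (exp_coeff a) N ^+ 2.
  rewrite sum2E pow2E -poly_opB (le_trans (poly_op_norm_le _ (D_ge0 N)))//.
  by rewrite hornerD hornerN hornerM e2E eE expr2.
have NN : (N + N)%N @[N --> \oo] --> \oo.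
  move=> P [n _ nP]; exists n => // m /= nm; apply: nP => /=.
  by rewrite (leq_trans nm)// leq_addl.
have cv0 : series (exp_coeff (2 * a)) (N + N)%N - series (exp_coeff a) N ^+ 2
    @[N --> \oo] --> (0 : R).
  have -> : 0 = expR (2 * a) - expR a ^+ 2.
    by rewrite mulr2n mulrDl !mul1r expRD expr2 subrr.
  apply: cvgB.
    by apply: cvg_comp NN _; exact: is_cvg_series_exp_coeff.
  by rewrite expr2; apply: cvgM; exact: is_cvg_series_exp_coeff.
apply/eqP; rewrite -subr_eq0; apply/eqP.
have lim1 : exp_sum (2 *: A) (N + N)%N - pow_op (exp_sum A N) 2
   @[N --> \oo] --> exp_op (2 *: A) - pow_op (exp_op A) 2.
  apply: cvgB; first by apply: cvg_comp NN _; exact: cvg_exp_sum.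
  by apply: cvg_pow2; exact: cvg_exp_sum.
apply: (@cvg_unique _ (@norm_hausdorff _ _) _ _ _ _ lim1).
apply/cvgrPdist_le => d d0.
move/cvgrPdist_le : cv0 => /(_ _ d0); apply: filterS => n.
rewrite !sub0r !normrN; apply: le_trans.
by rewrite (le_trans (bound n))// ler_norm.
Qed.

End operator_exponential.

(** * The operator logarithm *)

Lemma expr_small {R : realType} (x e : R) : 0 <= x -> x < 1 -> 0 < e ->
  exists n, x ^+ n <= e.
Proof.
move=> x0 x1 e0; have xn : `|x| < 1 by rewrite ger0_norm.
have /cvgrPdist_le/(_ _ e0) [n _ /(_ n) /=] := cvg_expr xn.
by rewrite leqnn sub0r normrN ger0_norm ?exprn_ge0// => /(_ isT); exists n.
Qed.

Section logarithm.
Context {R : realType} {E : hilbertType R}.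
Implicit Types (u v w : E) (A B S T L : hermOp E).
Local Open Scope complex_scope.

(** The exponential of [A] is the square of that of [A / 2]. *)
Lemma exp_op_ge0 A u : 0 <= qf (exp_op A) u.
Proof.
have h : 2 *: (2^-1 *: A) = A by rewrite scalerA mulfV// scale1r.
have hh v : exp_op (2^-1 *: A) (exp_op (2^-1 *: A) v) = exp_op A v.
  by rewrite -exp_op_double h.
by rewrite -(hnorm_sqr_qf u hh) sqr_ge0.
Qed.

(** A fixpoint of [L |-> L - (exp L - A)]. On the ball of radius 1/4 this map is a contraction of
    constant [(1/4) / (1 - 1/4) = 1/3], and the ball is preserved because
    [1/6 + 1/3 * 1/4 = 1/4]. *)
Lemma exp_op_surj_near1 A : `|A - id_op| <= 6^-1 -> exists L, exp_op L = A.
Proof.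
move=> A1; pose f L : hermOp E := L - (exp_op L - A).
have q0 : 0 <= 4^-1 :> R by [].
have q1 : 4^-1 < 1 :> R by lra.
have q13 : 4^-1 / (1 - 4^-1) = 3^-1 :> R by field.
have r0 : 0 <= 3^-1 :> R by [].
have r1 : 3^-1 < 1 :> R by lra.
have [||L _ fL] := @fixpoint_ball R (hermOp E) f 4^-1 3^-1 q0 r0 r1.
- move=> L Lq; have := exp_op_small q0 q1 Lq; rewrite q13 => h.
  have -> : f L = (A - id_op) - (exp_op L - id_op - L).
    rewrite /f (opprB (exp_op L - id_op)) addrCA (opprB (exp_op L) id_op).
    by rewrite (addrA (A - id_op)) subrK (opprB _ A).
  rewrite (le_trans (ler_normB _ _))//.
  have : `|exp_op L - id_op - L| <= 3^-1 * 4^-1.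
    by rewrite (le_trans h)// ler_wpM2l.
  lra.
- move=> L L' Lq Lq'; have := exp_op_diff q0 q1 Lq Lq'; rewrite q13.
  have -> : exp_op L - exp_op L' - (L - L') = - (f L - f L').
    rewrite /f [RHS]opprB (opprB _ A) (opprB _ A) [in RHS]opprD [RHS]addrACA.
    rewrite (opprB A).
    by rewrite [in RHS](addrC (A - _)) (addrA (_ - A)) subrK addrC opprB.
  by rewrite normrN.
exists L; move: fL; rewrite /f => /eqP; rewrite -subr_eq0 addrAC subrr add0r.
by rewrite oppr_eq0 subr_eq0 => /eqP.
Qed.

(** Taking [k] square roots brings the bounds to [1 - 1/6] and [1 + 1/6]; the logarithm found there
    is doubled [k] times on the way back. *)
Lemma exp_op_surj_pow k A :
  (forall u, (5 / 6) ^+ (2 ^ k) * hnorm u ^+ 2 <= qf A u) ->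
  (forall u, qf A u <= (7 / 6) ^+ (2 ^ k) * hnorm u ^+ 2) ->
  exists L, exp_op L = A.
Proof.
elim: k A => [|k IHk] A Al Au.
  apply: exp_op_surj_near1; rewrite opnormE; apply: opnorm_le_qf => // u.
  have := Al u; have := Au u; rewrite qfB qf_id expn0 !expr1 ler_norml.
  by move=> h1 h2; apply/andP; split; lra.
have [|S Sc SA] := @coercive_sqrt _ _ A.
  by exists ((5 / 6) ^+ (2 ^ k.+1)) => //; rewrite exprn_gt0//; lra.
have sqE (c : R) u : (c ^+ (2 ^ k) *: (id_op : hermOp E))
    ((c ^+ (2 ^ k) *: (id_op : hermOp E)) u) = (c ^+ (2 ^ k.+1) *: (id_op : hermOp E)) u.
  by rewrite !hopZ scalerA -rmorphM /= -exprD addnn -mul2n expnS.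
have ge0 (c : R) : 0 <= c -> forall u, 0 <= qf (c ^+ (2 ^ k) *: (id_op : hermOp E)) u.
  by move=> c0 u; rewrite qfZ qf_id mulr_ge0 ?sqr_ge0 ?exprn_ge0.
have [|u|L SL] := IHk S.
- move=> u; have := @sqrt_mono _ _ _ _ _ _ (coercive_ge0 Sc) (sqE (5 / 6)) SA.
  by move=> /(_ _ u); rewrite qfZ qf_id; apply => v; rewrite qfZ qf_id.
- have := @sqrt_mono _ _ _ _ _ _ (ge0 (7 / 6) _) SA (sqE (7 / 6)).
  move=> /(_ _ _ u); rewrite qfZ qf_id; apply; first by lra.
  by move=> v; rewrite qfZ qf_id.
exists (2 *: L); apply: hermOp_ext => u.
by rewrite exp_op_double SL SA.
Qed.

Lemma exp_op_surj A : coercive A -> exists L, exp_op L = A.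
Proof.
move=> [m m0 Am].
have [n1 h1] : exists n, (5 / 6) ^+ n <= m by apply: expr_small => //; lra.
have M0 : 0 < opnorm A + 1 by rewrite ltr_wpDl ?opnorm_ge0.
have [n2 h2] : exists n, (6 / 7) ^+ n <= (opnorm A + 1)^-1.
  by apply: expr_small; rewrite ?invr_gt0//; lra.
pose k := maxn n1 n2.
have kk : (k <= 2 ^ k)%N by rewrite ltnW// ltn_expl.
apply: (@exp_op_surj_pow k) => u.
  rewrite (le_trans _ (Am u))// ler_wpM2r ?sqr_ge0// (le_trans _ h1)//.
  by rewrite ler_wiXn2l ?(leq_trans (leq_maxl _ _) kk)//; lra.
rewrite (le_trans (qf_le _ _))// ler_wpM2r ?sqr_ge0//.
rewrite (@le_trans _ _ (opnorm A + 1)) ?lerDl//.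
have -> : (7 / 6) ^+ (2 ^ k) = ((6 / 7) ^+ (2 ^ k))^-1 :> R.
  by rewrite -exprVn; congr (_ ^+ _); field.
have p0 : 0 < (6 / 7) ^+ (2 ^ k) :> R by rewrite exprn_gt0//; lra.
rewrite -[leLHS]invrK lef_pV2 ?posrE ?invr_gt0//.
by rewrite (le_trans _ h2)// ler_wiXn2l ?(leq_trans (leq_maxr _ _) kk)//; lra.
Qed.

(** The choice made by [log_op] enters through this equation. That logarithms are unique is the case
    [d = 0] of [exp_op_le_shift]. *)
Lemma exp_log_op A : coercive A -> exp_op (log_op A) = A.
Proof. by move=> /exp_op_surj Aex; exact: (xgetPex 0 Aex). Qed.

(** Each halving of the exponents is a square root of both sides, which [sqrt_mono] allows. *)
Lemma exp_op_half_le B1 B2 (d : R) k :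
  (forall u, qf (exp_op B1) u <= expR d * qf (exp_op B2) u) ->
  forall u, qf (exp_op (2^-1 ^+ k *: B1)) u <=
    expR (2^-1 ^+ k * d) * qf (exp_op (2^-1 ^+ k *: B2)) u.
Proof.
move=> B12; elim: k => [|k IHk].
  by move=> u; rewrite expr0 !scale1r mul1r.
pose h : R := 2^-1 ^+ k.+1.
have dbl B v : exp_op (h *: B) (exp_op (h *: B) v) = exp_op (2^-1 ^+ k *: B) v.
  by rewrite -exp_op_double scalerA /h exprS mulrA mulfV// mul1r.
move=> u; rewrite -qfZ.
apply: (@sqrt_mono _ _ (exp_op (2^-1 ^+ k *: B1))
  (expR (2^-1 ^+ k * d) *: exp_op (2^-1 ^+ k *: B2))).
- by move=> v; rewrite qfZ mulr_ge0 ?expR_ge0 ?exp_op_ge0.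
- exact: dbl.
- move=> v; rewrite !hopZ hopZC scalerA dbl -rmorphM -expRD /=.
  by congr ((expR _)%:C *: _); rewrite -mulrDl exprS; field.
- by move=> v; rewrite qfZ IHk.
Qed.

(* Order preservation of the logarithm, from the square roots [exp (B / 2^k)]
   and [2^k (exp (B / 2^k) - 1) -> B]. *)
Lemma exp_op_le_shift B1 B2 (d : R) : 0 <= d ->
  (forall u, qf (exp_op B1) u <= expR d * qf (exp_op B2) u) ->
  forall u, qf B1 u <= qf B2 u + d * hnorm u ^+ 2.
Proof.
move=> d0 B12 u; apply/ler_addgt0Pl => e e0.
pose b := `|B1| + `|B2| + d + 1.
have b0 : 0 < b by rewrite ltr_wpDl// !addr_ge0.
pose N := hnorm u ^+ 2.
have N0 : 0 <= N by rewrite sqr_ge0.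
(* The 5 collects two errors [2 (h b)^2 N] of the expansions of [exp (h B1)] and [exp (h B2)], and
   the cross term [h d * h q1 <= (h b)^2 N]. *)
pose C := 5 * b ^+ 2 * N + 1.
have C0 : 0 < C by rewrite ltr_wpDl// mulr_ge0// mulr_ge0// sqr_ge0.
have [k hk] : exists k, 2^-1 ^+ k <= Num.min (2^-1 / b) (e / C).
  by apply: expr_small; rewrite ?lt_min ?divr_gt0//; lra.
pose h : R := 2^-1 ^+ k.
have h0 : 0 < h by rewrite exprn_gt0.
move: hk; rewrite le_min -/h => /andP[]; rewrite !ler_pdivlMr// => hb hC.
have est B : `|B| <= b ->
    `|qf (exp_op (h *: B)) u - N - h * qf B u| <= 2 * (h * b) ^+ 2 * N.
  move=> Bb; have nhB : `|h *: B| <= h * b.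
    by rewrite normrZ gtr0_norm// ler_pM2l.
  have hb0 : 0 <= h * b by rewrite mulr_ge0// ltW.
  have hb1 : h * b < 1 by lra.
  have := exp_op_small hb0 hb1 nhB.
  have -> : qf (exp_op (h *: B)) u - N - h * qf B u =
     qf (exp_op (h *: B) - id_op - h *: B) u by rewrite !qfB qf_id qfZ.
  move=> le1; rewrite (le_trans (qf_abs_le _ _))// ler_wpM2r//.
  rewrite -opnormE (le_trans le1)//.
  have : h * b / (1 - h * b) <= 2 * (h * b).
    rewrite ler_pdivrMr ?subr_gt0//.
    have : 0 <= (h * b) * (1 - 2 * (h * b)) by rewrite mulr_ge0//; lra.
    lra.
  move=> le2; rewrite (@le_trans _ _ (2 * (h * b) * (h * b)))//.
    by rewrite ler_pM// divr_ge0// subr_ge0 ltW.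
  by rewrite -mulrA -expr2.
have B1b : `|B1| <= b by rewrite /b; have := normr_ge0 B2; lra.
have B2b : `|B2| <= b by rewrite /b; have := normr_ge0 B1; lra.
have db : d <= b by rewrite /b; have := normr_ge0 B1; have := normr_ge0 B2; lra.
have := est _ B1b; have := est _ B2b; rewrite !ler_norml.
set Q1 := qf (exp_op (h *: B1)) u; set Q2 := qf (exp_op (h *: B2)) u.
set q1 := qf B1 u; set q2 := qf B2 u.
move=> /andP[_ e2] /andP[e1 _].
(* The factor [exp (h d)] is moved to the left and replaced by [1 - h d <= exp (- h d)], so that
   only first-order terms in [h] remain to be compared. *)
have Q12 : (1 - h * d) * Q1 <= Q2.
  have Q2_ge0 : 0 <= Q2 by exact: exp_op_ge0.
  have hd : h * d <= h * b by rewrite ler_pM2l.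
  have hd1 : 0 <= 1 - h * d by lra.
  rewrite (le_trans (ler_wpM2l hd1 (exp_op_half_le k B12 u)))// -/h mulrA.
  rewrite ler_piMl// -(@ler_pM2l _ (expR (- (h * d)))) ?expR_gt0//.
  rewrite mulrCA -expRD addNr expR0 !mulr1.
  by have := expR_ge1Dx (- (h * d)); lra.
have q1b : q1 <= b * N by rewrite (le_trans (qf_le _ _))// ler_wpM2r.
have hd0 : 0 <= h * d by rewrite mulr_ge0// ltW.
have s1 : (1 - h * d) * (N + h * q1 - 2 * (h * b) ^+ 2 * N) <= Q2.
  rewrite (le_trans _ Q12)// ler_wpM2l//.
    by have : h * d <= h * b by [rewrite ler_pM2l]; lra.
  by lra.
have s2 : h * (q1 - q2 - d * N) <= h * (h * (5 * b ^+ 2 * N)).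
  have t1 : 0 <= (h * d) * (2 * (h * b) ^+ 2 * N).
    by rewrite mulr_ge0// mulr_ge0// mulr_ge0// sqr_ge0.
  have t2 : h * d * (h * q1) <= h * b * (h * (b * N)).
    rewrite (@le_trans _ _ (h * d * (h * (b * N))))//.
      by rewrite ler_wpM2l// ler_pM2l.
    by rewrite ler_wpM2r ?ler_pM2l// mulr_ge0 ?(ltW h0)// mulr_ge0 ?(ltW b0).
  lra.
move: s2; rewrite ler_pM2l// => s2.
have : h * (5 * b ^+ 2 * N) <= e.
  rewrite (le_trans _ hC)// ler_wpM2l ?(ltW h0)// /C lerDl//.
rewrite /N in s2 *; lra.
Qed.

Lemma log_op_lipschitz A B (d : R) : coercive A -> coercive B -> 0 <= d ->
  (forall u, qf A u <= expR d * qf B u) ->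
  (forall u, qf B u <= expR d * qf A u) ->
  `|log_op A - log_op B| <= d.
Proof.
move=> cA cB d0 AB BA; rewrite opnormE; apply: opnorm_le_qf => // u.
rewrite qfB ler_norml lerBlDl lerNl opprB lerBlDl.
by apply/andP; split; apply: exp_op_le_shift => //; rewrite !exp_log_op.
Qed.

Lemma log_op_id : log_op (id_op : hermOp E) = 0.
Proof.
have c1 : coercive (id_op : hermOp E) by exists 1 => // u; rewrite mul1r qf_id.
have lt (L : hermOp E) : exp_op L = id_op -> L = 0.
  move=> L1; apply/eqP; rewrite -normr_le0 opnormE.
  apply: opnorm_le_qf => // u; rewrite mul0r normr_le0 eq_le.
  have := @exp_op_le_shift L 0 0 (lexx _); have := @exp_op_le_shift 0 L 0 (lexx _).
  rewrite L1 exp_op0 expR0.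
  have q0 : qf (0 : hermOp E) u = 0 by rewrite -(subrr L) qfB subrr.
  move=> /(_ _ u) h1 /(_ _ u) h2; move: h1 h2; rewrite q0 mul0r !addr0.
  by move=> -> => [->//|]; move=> v; rewrite mul1r.
exact/lt/exp_log_op.
Qed.

End logarithm.

(** * Continuity of the Karcher logarithm *)

Section karcher_log_continuity.
Context {R : realType} {E : hilbertType R}.
Implicit Types (u v w : E) (A B S T C : hermOp E) (x y a b : posCone E).
Local Open Scope complex_scope.

(** The root is chosen by [xget], so a root inside the cone has to be exhibited; the inverse of [S]
    is [S x^-1]. *)
Lemma sqrt_coneK x u : sqrt_cone x (sqrt_cone x u) = x u.
Proof.
suff : exists y, forall u, y (y u) = x u.
  by move=> xex; exact: (xgetPex cone1 xex).
have [S Sc SS] := coercive_sqrt (posCone_coercive x).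
have Sp : positive_op S by apply/positive_opP; exact: coercive_ge0.
have Si : invertible_op S.
  have [g [gb xg gx]] := cone_inv x.
  have Sr v : S (S (g v)) = v by rewrite SS gx.
  exists (S \o g); split.
  - by apply: bounded_operator_comp => //; exact: hop_bounded.
  - by move=> v /=; rewrite -[RHS]xg -[LHS]xg -!SS Sr.
  - by move=> v /=; rewrite Sr.
by exists (PosCone Sp Si).
Qed.

Lemma inv_coneP x : cancel x (inv_cone x) /\ cancel (inv_cone x) x.
Proof.
suff : exists y, cancel x y /\ cancel y x.
  by move=> xex; exact: (xgetPex cone1 xex).
have [g [gb xg gx]] := cone_inv x.
have ga : self_adjoint g by move=> u v; rewrite -{2}(gx u) hop_adj gx.
pose G := HermOp gb ga.
have Gp : positive_op G.
  by move=> u; have := cone_pos x (g u); rewrite gx -(ga u u).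
have Gi : invertible_op G by exists x; split=> //; exact: hop_bounded.
by exists (PosCone Gp Gi).
Qed.

Lemma inv_coneK x : cancel x (inv_cone x). Proof. by case: (inv_coneP x). Qed.
Lemma inv_coneVK x : cancel (inv_cone x) x. Proof. by case: (inv_coneP x). Qed.

(** Inversion reverses the order: positivity of [x] is tested at [z - t^-1 w], where
    [x z = u = y w]. *)
Lemma inv_cone_le x y (t : R) : 0 < t -> (forall u, qf x u <= t * qf y u) ->
  forall u, qf (inv_cone y) u <= t * qf (inv_cone x) u.
Proof.
move=> t0 xy u; set z := inv_cone x u; set w := inv_cone y u.
have := cone_qf_ge0 x (z - t^-1%:C *: w).
rewrite qf_sub qf_scale rdotZr /z inv_coneVK -/z.
have -> : qf x z = qf (inv_cone x) u by rewrite /qf /z inv_coneVK rdotC.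
have -> : rdot u w = qf (inv_cone y) u by rewrite rdotC.
have := xy w; have -> : qf y w = qf (inv_cone y) u.
  by rewrite /qf /w inv_coneVK rdotC.
set p := qf (inv_cone x) u; set q := qf (inv_cone y) u => h1 h2.
have h3 : t^-1 ^+ 2 * qf x w <= t^-1 * q.
  by rewrite expr2 -mulrA ler_pM2l ?invr_gt0// ler_pdivrMl.
have : 0 <= p - t^-1 * q by lra.
by rewrite subr_ge0 ler_pdivrMl.
Qed.

Lemma congr_op_coercive y A : coercive A -> coercive (congr_op y A).
Proof.
move=> [m m0 Am]; have [c c0 yc] := posCone_coercive y.
exists (m * c ^+ 2); first by rewrite mulr_gt0 ?exprn_gt0.
move=> u; have -> : qf (congr_op y A) u = qf A (y u).
  by rewrite /qf /= rdot_hop.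
rewrite (le_trans _ (Am _))// -mulrA ler_pM2l// -exprMn.
rewrite lerXn2r ?nnegrE ?mulr_ge0 ?hnorm_ge0 ?(ltW c0)//.
have [u0|u0] := eqVneq (hnorm u) 0; first by rewrite u0 mulr0 hnorm_ge0.
have uu : 0 < hnorm u by rewrite lt_neqAle eq_sym u0 hnorm_ge0.
rewrite -(ler_pM2r uu) -mulrA -expr2 (le_trans (yc u))//.
exact: rdot_le.
Qed.

(** Congruence by [x^(-1/2)] preserves the two inequalities [a <= e^d b] and [b <= e^d a], whatever
    [x] is. *)
Lemma karcher_log_dist x a b :
  `|karcher_log x a - karcher_log x b| <= thompson a b.
Proof.
have d0 : 0 <= thompson a b by rewrite -mdist_thompson mdist_ge0.
apply: log_op_lipschitz => //;
  try by apply: congr_op_coercive; exact: posCone_coercive.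
- by move=> u; have := thompson_qf a b (inv_cone (sqrt_cone x) u);
    rewrite /qf /= !rdot_hop.
- move=> u; rewrite thompson_sym.
  by have := thompson_qf b a (inv_cone (sqrt_cone x) u);
    rewrite /qf /= !rdot_hop.
Qed.

Lemma karcher_log_norm x a : `|karcher_log x a| <= thompson a x.
Proof.
have <- : karcher_log x a - karcher_log x x = karcher_log x a.
  rewrite {2}/karcher_log.
  have -> : congr_op (inv_cone (sqrt_cone x)) x = id_op.
    by apply: hermOp_ext => u /=; rewrite -(sqrt_coneK x) inv_coneVK inv_coneK.
  by rewrite log_op_id subr0.
exact: karcher_log_dist.
Qed.

Lemma sqrt_cone_le x y (d : R) : (forall u, qf x u <= expR d * qf y u) ->
  forall u, qf (sqrt_cone x) u <= expR (d / 2) * qf (sqrt_cone y) u.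
Proof.
move=> xy u; rewrite -qfZ.
apply: (@sqrt_mono _ _ x (expR d *: (y : hermOp E))).
- by move=> v; rewrite qfZ mulr_ge0 ?expR_ge0 ?cone_qf_ge0.
- exact: sqrt_coneK.
- move=> v; rewrite !hopZ hopZC scalerA sqrt_coneK -rmorphM -expRD /=.
  by rewrite -splitr.
- by move=> v; rewrite qfZ.
Qed.

(** Converts a multiplicative comparison of forms into a norm bound; the lower side rests on
    [1 - t^-1 <= t - 1]. *)
Lemma opnorm_close A B (t : R) : 1 <= t -> (forall u, 0 <= qf B u) ->
  (forall u, qf A u <= t * qf B u) -> (forall u, qf B u <= t * qf A u) ->
  `|A - B| <= (t - 1) * `|B|.
Proof.
move=> t1 B0 AB BA; rewrite opnormE; apply: opnorm_le_qf.
  by rewrite mulr_ge0 ?normr_ge0// subr_ge0.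
move=> u; rewrite (@le_trans _ _ ((t - 1) * qf B u))//.
  rewrite qfB ler_norml; apply/andP; split; last first.
    by have := AB u; lra.
  rewrite -(@ler_pM2l _ t); last lra.
  have h : 0 <= (t - 1) ^+ 2 * qf B u by rewrite mulr_ge0// sqr_ge0.
  by have := BA u; lra.
by rewrite -mulrA ler_wpM2l ?subr_ge0// qf_le.
Qed.

(** If [x_n] and [x] compare with factor [e^d], their square roots compare with factor [e^(d/2)],
    and so do the inverses of these roots. *)
Lemma inv_sqrt_cone_cvg (x_ : nat -> posCone E) x :
  thompson (x_ n) x @[n --> \oo] --> (0 : R) ->
  ((inv_cone (sqrt_cone (x_ n)) : hermOp E)) @[n --> \oo] -->
  (inv_cone (sqrt_cone x) : hermOp E).
Proof.
move=> xx; pose t n := expR (thompson (x_ n) x / 2).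
have t_cvg : (t n - 1) * `|(inv_cone (sqrt_cone x) : hermOp E)| @[n --> \oo] --> (0 : R).
  rewrite -[0](mul0r `|(inv_cone (sqrt_cone x) : hermOp E)|).
  apply: cvgMl; rewrite -(subrr 1); apply: cvgB; last exact: cvg_cst.
  rewrite -expR0; apply: (@cvg_comp _ _ _ _ expR _ _ _ _ (@continuous_expR R 0)).
  by rewrite -(mul0r 2^-1); apply: cvgMl.
apply/cvgrPdist_le => e e0.
move/cvgrPdist_le : t_cvg => /(_ _ e0); apply: filterS => n.
rewrite sub0r normrN => h; rewrite distrC.
have d0 : 0 <= thompson (x_ n) x by rewrite -mdist_thompson mdist_ge0.
apply: (le_trans _ (le_trans (ler_norm _) h)); apply: opnorm_close.
- by rewrite -expR0 ler_expR divr_ge0.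
- exact: cone_qf_ge0.
- apply: inv_cone_le; first exact: expR_gt0.
  by apply: sqrt_cone_le => u; rewrite thompson_sym thompson_qf.
- apply: inv_cone_le; first exact: expR_gt0.
  by apply: sqrt_cone_le => u; rewrite thompson_qf.
Qed.

Lemma congr_op_dist A B C :
  `|congr_op A C - congr_op B C| <= `|A - B| * (`|C| * (`|A| + `|B|)).
Proof.
rewrite !opnormE; apply: opnorm_le.
  by rewrite !mulr_ge0 ?addr_ge0 ?opnorm_ge0.
move=> u; have -> : (congr_op A C - congr_op B C) u =
    (A - B) (C (A u)) + B (C ((A - B) u)).
  by rewrite !hopB /= !linearB addrA subrK.
rewrite (le_trans (Defs.hnormD _ _))//.
have -> : opnorm (A - B) * (opnorm C * (opnorm A + opnorm B)) * hnorm u =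
  opnorm (A - B) * (opnorm C * (opnorm A * hnorm u)) +
  opnorm B * (opnorm C * (opnorm (A - B) * hnorm u)) by ring.
have bd S v (r : R) : hnorm v <= r -> hnorm (S v) <= opnorm S * r.
  by move=> vr; rewrite (le_trans (opnorm_bound _ _))// ler_wpM2l ?opnorm_ge0.
by apply: lerD; apply: (bd) => //; apply: (bd) => //; exact: opnorm_bound.
Qed.

(** Since [m <= C], an error of norm at most [m (1 - e^-r)] gives
    [e^-r C <= C_n <= (2 - e^-r) C <= e^r C], and [log_op_lipschitz] applies with [d = r]. *)
Lemma log_op_cvg (C_ : nat -> hermOp E) C : coercive C ->
  (forall n, coercive (C_ n)) -> C_ n @[n --> \oo] --> C ->
  log_op (C_ n) @[n --> \oo] --> log_op C.
Proof.
move=> cC cCn CC; have [m m0 Cm] := cC.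
apply/cvgrPdist_le => e e0.
have ee : expR (- e) < 1 by rewrite -expR0 ltr_expR oppr_lt0.
have d0 : 0 < m * (1 - expR (- e)) by rewrite mulr_gt0// subr_gt0.
move/cvgrPdist_le : CC => /(_ _ d0); apply: filterS => n Cn.
have key u : `|qf C u - qf (C_ n) u| <= (1 - expR (- e)) * qf C u.
  rewrite -qfB (le_trans (qf_abs_le _ _))//.
  rewrite (@le_trans _ _ (m * (1 - expR (- e)) * hnorm u ^+ 2))//.
    by rewrite ler_wpM2r ?sqr_ge0.
  by rewrite mulrAC mulrC ler_wpM2l// subr_ge0 ltW.
have eee : expR e * expR (- e) = 1 by rewrite -expRD subrr expR0.
apply: log_op_lipschitz => //; first exact: ltW.
  move=> u; have := key u; rewrite ler_norml => /andP[_ h].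
  have h2 : expR (- e) * qf C u <= qf (C_ n) u by lra.
  have := ler_wpM2l (expR_ge0 e) h2.
  by rewrite mulrA eee mul1r.
move=> u; have := key u; rewrite ler_norml => /andP[h _].
have h3 : (2 - expR (- e)) * qf C u <= expR e * qf C u.
  rewrite ler_wpM2r ?coercive_ge0// -(ler_pM2r (expR_gt0 (- e))) eee.
  by have := sqr_ge0 (expR (- e) - 1); lra.
lra.
Qed.

Lemma karcher_log_cvg (x_ : nat -> posCone E) x a :
  thompson (x_ n) x @[n --> \oo] --> (0 : R) ->
  karcher_log (x_ n) a @[n --> \oo] --> karcher_log x a.
Proof.
move=> /inv_sqrt_cone_cvg; set y_ := fun n => _; set y : hermOp E := inv_cone _.
move=> yy; apply: log_op_cvg.
- exact/congr_op_coercive/posCone_coercive.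
- by move=> n; exact/congr_op_coercive/posCone_coercive.
have h : `|y - y_ n| * (`|(a : hermOp E)| * (`|y| + `|y_ n|)) @[n --> \oo] --> (0 : R).
  rewrite -(mul0r (`|(a : hermOp E)| * (`|y| + `|y|))); apply: cvgM.
    rewrite -(@normr0 _ (hermOp E)) -(subrr y).
    by apply: cvg_norm; apply: cvgB => //; exact: cvg_cst.
  apply: cvgMr; apply: cvgD; first exact: cvg_cst.
  exact: cvg_norm.
apply/cvgrPdist_le => e e0.
move/cvgrPdist_le : h => /(_ _ e0); apply: filterS => n.
rewrite sub0r normrN => h; apply: (le_trans _ (le_trans (ler_norm _) h)).
exact: congr_op_dist.
Qed.

End karcher_log_continuity.

(** * Borel measures *)

Section weighted_dirac.
Context d {T : measurableType d} {R : realType}.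
Implicit Types (s : seq (R * T)).
Local Open Scope ereal_scope.

(** Weighted lists of points produce the measure with exact masses, the uniform measure and the
    coupling between them, the last one by concatenation. *)
Lemma weighted_dirac_probability s :
  (forall x, x \in s -> (0 <= x.1)%R) -> (\sum_(x <- s) x.1)%R = 1%R ->
  exists P : probability T R,
    (forall A, measurable A -> P A = \sum_(x <- s) (x.1%:E * \d_(x.2) A)) /\
    (forall f : T -> \bar R, measurable_fun setT f -> (forall t, 0 <= f t) ->
      \int[P]_t f t = \sum_(x <- s) (x.1%:E * f x.2)).
Proof.
move=> s0 s1; pose x0 : R * T := (0%R, point).
(* The absolute value makes the weight nonnegative at every index; on the list it changes
   nothing. *)
pose w k : {nonneg R} := NngNum (normr_ge0 (nth x0 s k).1).
pose m := msum (fun k => mscale (w k) \d_((nth x0 s k).2)) (size s).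
have wE k : (k < size s)%N -> (w k)%:num = (nth x0 s k).1.
  by move=> ks; rewrite /w /= ger0_norm// s0// mem_nth.
have mE A : m A = \sum_(x <- s) (x.1%:E * \d_(x.2) A).
  rewrite /m /msum (big_nth x0) big_mkord; apply: eq_bigr => i _.
  by rewrite -(wE _ (ltn_ord i)).
have m1 : m setT = 1.
  rewrite mE; under eq_bigr do rewrite diracT mule1.
  by rewrite sumEFin s1.
pose P : probability T R := HB.pack m (Measure_isProbability.Build _ _ _ m m1).
exists P; split => [A _|f mf f0]; first exact: mE.
rewrite [LHS](_ : _ = \int[m]_t f t)// ge0_integral_measure_sum//.
rewrite (big_nth x0) big_mkord; apply: eq_bigr => i _.
rewrite ge0_integral_mscale// integral_dirac// diracT mul1e.
by rewrite -(wE _ (ltn_ord i)).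
Qed.

End weighted_dirac.

Section borel_sets.
Context {R : realType} {T : ptopologicalType}.

Lemma borel_open (U : set T) : open U -> measurable (U : set (borel T)).
Proof. exact: sub_sigma_algebra. Qed.

Lemma borel_closed (C : set T) : closed C -> measurable (C : set (borel T)).
Proof.
by move=> cC; rewrite -(setCK C); apply: measurableC; apply: borel_open;
  exact: closed_openC.
Qed.

Lemma continuous_borel_measurable (U : ptopologicalType) (f : T -> U) :
  continuous f -> measurable_fun setT (f : borel T -> borel U).
Proof.
move=> /continuousP cf.
apply: (@measurability _ _ (borel T) (borel U) setT f (@open U) erefl).
by move=> _ [B oB <-]; rewrite setTI; apply: borel_open; exact: cf.
Qed.

Lemma continuous_borel_measurableR (f : T -> R) :
  continuous f -> measurable_fun setT (f : borel T -> R).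
Proof.
move=> /continuousP cf; apply: (measurability _ (RGenOpens.measurableE R)) => //.
move=> _ [_ [a [b ->] <-]]; rewrite setTI; apply: borel_open.
exact/cf/interval_open.
Qed.

Lemma support_closed (mu : probability (borel T) R) : closed (Defs.support mu).
Proof.
rewrite -[X in closed X]setCK; apply: open_closedC.
rewrite openE => x /= /existsNP[U /not_implyP[oU /not_implyP[Ux mU]]].
rewrite /interior nbhsE; exists U => // y Uy /(_ U oU Uy).
exact: mU.
Qed.

(** Points of positive weight lie in the support, and the others contribute 0 to both masses. *)
Lemma supported_weighted_dirac (s : seq (R * T)) (mu : probability (borel T) R) :
  (forall x, x \in s -> (0 <= x.1)%R) ->
  (forall A : set (borel T), measurable A ->
    mu A = \sum_(x <- s) (x.1%:E * \d_(x.2 : borel T) A))%E ->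
  supported mu.
Proof.
move=> s0 muE.
have m1 := probability_setT mu.
rewrite /supported -m1 (muE _ (borel_closed (@support_closed mu))) muE//.
apply: eq_big_seq => x xs.
have [x10|x10] := eqVneq x.1 0; first by rewrite x10 !mul0e.
rewrite !diracE in_setT mem_set// => U oU Ux.
rewrite muE; last exact: borel_open.
rewrite (big_rem x)//= lte_paddr//.
  rewrite big_seq_cond; apply: sume_ge0 => y /andP[/mem_rem ys _].
  by rewrite mule_ge0// lee_fin s0.
by rewrite diracE mem_set// mule1 lte_fin lt_neqAle eq_sym x10 s0.
Qed.

End borel_sets.

(** * Separability of supports and nearest points *)

Section metric_borel.
Context {R : realType} {X : pmetricType R}.
Implicit Types (a b : X) (r e : R).

Lemma open_mdist_ball (q : X) r : open [set t | mdist t q < r].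
Proof.
rewrite openE => t /= tr; rewrite /interior -nbhs_ballE.
exists (r - mdist t q); first by rewrite /= subr_gt0.
move=> z; rewrite ballEmdist /= => tz.
rewrite (le_lt_trans (metric_triangle _ t _))// metric_sym.
by rewrite -ltrBrDr.
Qed.

Lemma continuous_mdist : continuous (fun z : X * X => mdist z.1 z.2).
Proof.
move=> [z1 z2]; apply/cvgrPdist_lt => e e0.
have e2 : 0 < e / 2 by rewrite divr_gt0.
near=> w => /=.
have h1 : mdist z1 w.1 < e / 2.
  near: w; exists (ball z1 (e / 2), setT) => /=.
    by split; [exact: nbhsx_ballx|exact: filterT].
  by move=> w [/= + _]; rewrite ballEmdist.
have h2 : mdist z2 w.2 < e / 2.
  near: w; exists (setT, ball z2 (e / 2)) => /=.
    by split; [exact: filterT|exact: nbhsx_ballx].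
  by move=> w [/= _]; rewrite ballEmdist.
have h3 := metric_triangle z1 w.1 z2; have h4 := metric_triangle w.1 w.2 z2.
have h5 := metric_triangle w.1 z1 w.2; have h6 := metric_triangle z1 z2 w.2.
rewrite (metric_sym w.2 z2) in h4; rewrite (metric_sym w.1 z1) in h5.
by rewrite ltr_norml; apply/andP; split; lra.
Unshelve. all: by end_near. Qed.

Lemma continuous_pairr (q : X) : continuous (fun t : X => (t, q)).
Proof. by move=> t; apply: cvg_pair; [exact: cvg_id|exact: cvg_cst]. Qed.

Lemma measurable_mdist (q : X) :
  measurable_fun setT ((fun t => mdist t q) : borel X -> R).
Proof.
apply: continuous_borel_measurableR => t.
exact: (@cvg_comp _ _ _ (fun t : X => (t, q)) (fun z : X * X => mdist z.1 z.2)
  _ _ _ (@continuous_pairr q t) (@continuous_mdist (t, q))).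
Qed.

Variables (mu : probability (borel X) R).

(* The union of the balls of radius [r] centered at [s j] has almost the largest
   possible measure, so every ball around a point of the support meets one of
   these unions. *)
Lemma support_covered r : 0 < r -> exists s : nat -> seq X,
  forall a, Defs.support mu a ->
    exists j q, q \in s j /\ mdist a q < r + r.
Proof.
move=> r0.
pose U (s : seq X) : set X := \bigcup_(q in [set` s]) [set t | mdist t q < r].
have oU s : open (U s) by apply: bigcup_open => q _; exact: open_mdist_ball.
have mU s : measurable (U s : set (borel X)) by apply: borel_open.
have fU s : mu (U s) \is a fin_num by exact: fin_num_measure.
pose G : set R := [set fine (mu (U s)) | s in setT].
have hG : has_sup G.
  split; first by exists (fine (mu (U [::]))), [::].
  exists 1 => _ [s _ <-]; rewrite -lee_fin fineK//; exact: probability_le1.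
have exs j : exists s, sup G - j.+1%:R^-1 < fine (mu (U s)).
  have [|_ [s _ <-] ?] := @sup_adherent _ G j.+1%:R^-1 _ hG.
    by rewrite invr_gt0.
  by exists s.
have [s sP] := choice exs.
exists s => a sa; apply: contrapT => h.
pose B : set X := [set t | mdist t a < r].
have oB : open B by exact: open_mdist_ball.
have B0 : (0 < mu B)%E by apply: sa => //; rewrite /B /= mdistxx.
have fB : mu B \is a fin_num by apply: fin_num_measure; exact: borel_open.
have b0 : 0 < fine (mu B) by rewrite fine_gt0// B0/= ltey_eq fB.
have [j hj] : exists j : nat, j.+1%:R^-1 <= fine (mu B).
  have [j _ hj] := near_infty_natSinv_lt (PosNum b0).
  by exists j; apply: ltW; apply: (hj j) => /=.
have disj : B `&` U (s j) = set0.
  apply/seteqP; split => // t [/= Bt [q /= qs tq]].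
  apply: h; exists j, q; split => //.
  rewrite (le_lt_trans (metric_triangle _ t _))// metric_sym.
  exact: ltrD.
have UE : U (a :: s j) = B `|` U (s j).
  apply/seteqP; split => [t [q /=]|t [Bt|[q /= qs tq]]].
  - by rewrite inE => /orP[/eqP ->|qs tq]; [left|right; exists q].
  - by exists a => //=; rewrite mem_head.
  - by exists q => //=; rewrite inE qs orbT.
have : fine (mu (U (a :: s j))) <= sup G.
  by apply: ub_le_sup; [case: hG|exists (a :: s j)].
rewrite UE measureU//; last exact: borel_open.
rewrite fineD//; last exact: fU.
by move: (j.+1%:R^-1) hj (sP j) => c; lra.
Qed.

(** The finite lists obtained for the radii [1 / (m+1)] are enumerated through [pickle]. The default
    [point] at the other indices merely adds a term to the sequence. *)
Lemma dense_sequence_support : exists p : nat -> X,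
  forall a e, Defs.support mu a -> 0 < e -> exists k, mdist a (p k) < e.
Proof.
have exs m : exists s : nat -> seq X,
    forall a, Defs.support mu a ->
    exists j q, q \in s j /\ mdist a q < m.+1%:R^-1 + m.+1%:R^-1.
  by apply: support_covered; rewrite invr_gt0.
have [s sP] := choice exs.
exists (fun k =>
  if unpickle k is Some (m, j, i) then nth point (s m j) i else point).
move=> a e sa e0.
have e2 : 0 < e / 2 by rewrite divr_gt0.
have [m _ hm] := near_infty_natSinv_lt (PosNum e2).
have {}hm := hm m (leqnn m); rewrite /= in hm.
have [j [q [qs aq]]] := sP m a sa.
exists (pickle (m, j, index q (s m j))).
rewrite pickleK nth_index//.
by move: (m.+1%:R^-1) hm aq => c; lra.
Qed.

Variable p : nat -> X.

(* The index of a point nearest to [t] among [p 0], ..., [p n]. *)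
Fixpoint nearest n (t : X) : nat :=
  if n is k.+1 then
    if mdist t (p k.+1) < mdist t (p (nearest k t)) then k.+1 else nearest k t
  else 0%N.

Lemma nearest_le n t : (nearest n t <= n)%N.
Proof. by elim: n => //= n IHn; case: ifP => // _; rewrite ltnW. Qed.

Lemma mdist_nearest n t k : (k <= n)%N ->
  mdist t (p (nearest n t)) <= mdist t (p k).
Proof.
elim: n => [|n IHn]; first by rewrite leqn0 => /eqP ->.
rewrite leq_eqVlt => /orP[/eqP ->|] /=; first by case: ltP => // /ltW.
by rewrite ltnS => /IHn h; case: ltP => // /ltW h2; rewrite (le_trans h2).
Qed.

Lemma measurable_mdist_nearest n :
  measurable_fun setT ((fun t => mdist t (p (nearest n t))) : borel X -> R).
Proof.
elim: n => [|n IHn]; first exact: (measurable_mdist (p 0)).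

rewrite [X in measurable_fun _ X](_ : _ = (fun t => mdist t (p n.+1)) \min
  (fun t => mdist t (p (nearest n t))) :> (borel X -> R)).
  by apply: measurable_minr => //; exact: measurable_mdist.
by apply/funext => t /=; rewrite /Order.min; case: ifP.
Qed.

Lemma measurable_nearest n : measurable_fun setT (nearest n : borel X -> nat).
Proof.
elim: n => [|n IHn] /=; first exact: measurable_cst.
apply: measurable_fun_ifT => //.
exact: (@measurable_fun_ltr _ (borel X) R setT _ _ (measurable_mdist _)
  (measurable_mdist_nearest n)).
Qed.

Lemma measurable_nearest_fiber n k :
  measurable ((nearest n @^-1` [set k]) : set (borel X)).
Proof. by rewrite -[X in measurable X]setTI; apply: measurable_nearest. Qed.

Lemma cvg_mdist_nearest a :
  (forall e, 0 < e -> exists k, mdist a (p k) < e) ->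
  mdist a (p (nearest n a)) @[n --> \oo] --> (0 : R).
Proof.
move=> pa; apply/cvgrPdist_lt => e /pa[k ak]; exists k => // n /= kn.
rewrite sub0r normrN ger0_norm ?mdist_ge0//.
by rewrite (le_lt_trans _ ak)// mdist_nearest.
Qed.

End metric_borel.

(** * Approximation by uniform measures *)

(* The masses [w k] are rounded down to multiples of [N^-1], the rest being put
   on the index [0]. *)
Lemma round_weights {R : realType} (n N : nat) (w : nat -> R) :
  (0 < N)%N -> (forall k, 0 <= w k) -> \sum_(k < n.+1) w k = 1 ->
  exists (idx : 'I_N -> nat) (c : nat -> R),
    (forall k, [/\ 0 <= c k, c k <= w k & w k - c k <= N%:R^-1]) /\
    forall (V : lmodType R) (F : nat -> V),
      N%:R^-1 *: \sum_(i < N) F (idx i) =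
      \sum_(k < n.+1) c k *: F k + (1 - \sum_(k < n.+1) c k) *: F 0%N.
Proof.
move=> N0 w0 w1.
have NR : (0 : R) < N%:R by rewrite ltr0n.
pose m k := Num.truncn (N%:R * w k).
have mw k : (m k)%:R <= N%:R * w k < (m k).+1%:R.
  by apply: truncn_itv; rewrite mulr_ge0.
pose M := (\sum_(k < n.+1) m k)%N.
have MN : (M <= N)%N.
  rewrite -(ler_nat R) natr_sum.
  rewrite [leRHS](_ : _ = N%:R * \sum_(k < n.+1) w k); last by rewrite w1 mulr1.
  rewrite mulr_sumr.
  apply: ler_sum => k _; by have /andP[] := mw k.
pose s := flatten [seq nseq (m k) k | k <- iota 0 n.+1] ++ nseq (N - M) 0%N.
have sumE (V : nmodType) (F : nat -> V) :
    \sum_(x <- s) F x = \sum_(k < n.+1) F k *+ m k + F 0%N *+ (N - M).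
  rewrite big_cat big_flatten big_map /= -(big_mkord xpredT (fun k => F k *+ m k)).
  rewrite /index_iota subn0; congr (_ + _); last by rewrite big_nseq iter_addr_0.
  by apply: eq_bigr => k _; rewrite big_nseq iter_addr_0.
have size_s : size s = N.
  have := sumE nat (fun=> 1%N); rewrite sum1_size => ->.
  rewrite natn.
  under eq_bigr do rewrite natn.
  exact: subnKC.
exists (fun i => nth 0%N s i), (fun k => (m k)%:R / N%:R); split.
  move=> k; have /andP[h1 h2] := mw k; split.
  - by rewrite divr_ge0.
  - by rewrite ler_pdivrMr// mulrC.
  - rewrite lerBlDl -[X in _ + X]div1r -mulrDl ler_pdivlMr// mulrC ltW//.
    by rewrite (lt_le_trans h2)// -addn1 natrD addrC.
move=> V F.
have -> : \sum_(i < N) F (nth 0%N s i) = \sum_(x <- s) F x.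
  by rewrite (big_nth 0%N) size_s big_mkord.
rewrite sumE scalerDr scaler_sumr; congr (_ + _).
  by apply: eq_bigr => k _; rewrite -(scaler_nat (m k)) scalerA mulrC.
rewrite -(scaler_nat (N - M)) scalerA; congr (_ *: _).
by rewrite natrB// /M natr_sum mulrBr mulVf ?gt_eqF// mulrC mulr_suml.
Qed.

Section wasserstein_bounds.
Context {R : realType} {X : pmetricType R}.
Variables (mu : probability (borel X) R) (p : nat -> X) (n : nat).
Local Open Scope ereal_scope.

Definition cell_mass k : R := fine (mu (nearest p n @^-1` [set k])).

Lemma cell_mass_ge0 k : (0 <= cell_mass k)%R.
Proof. by rewrite fine_ge0. Qed.

Lemma measurable_nearest_dep (G : nat -> borel X -> R) :
  (forall k, measurable_fun setT (G k)) ->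
  measurable_fun setT (fun t : borel X => G (nearest p n t) t).
Proof.
move=> mG; elim: n => [|k IHk] /=; first exact: mG.
rewrite [X in measurable_fun _ X](_ : _ = fun t =>
  if (mdist (t : X) (p k.+1) < mdist (t : X) (p (nearest p k t)))%R
  then G k.+1 t else G (nearest p k t) t); last first.
  by apply/funext => t; case: ifP.
apply: measurable_fun_ifT => //.
exact: (@measurable_fun_ltr _ (borel X) R setT _ _ (measurable_mdist _)
  (measurable_mdist_nearest p k)).
Qed.

Lemma integral_nearest (G : nat -> R) : (forall k, (0 <= G k)%R) ->
  \int[mu]_t (G (nearest p n t))%:E = (\sum_(k < n.+1) cell_mass k * G k)%:E.
Proof.
move=> G0; pose B k : set (borel X) := nearest p n @^-1` [set k].
have mB k : measurable (B k) by exact: measurable_nearest_fiber.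
transitivity (\int[mu]_t \sum_(k < n.+1) ((G k)%:E * (\1_(B k) t)%:E)).
  apply: eq_integral => t _.
  have tn : (nearest p n t < n.+1)%N by rewrite ltnS nearest_le.
  rewrite (bigD1 (Ordinal tn))//= big1 ?adde0.
    by rewrite indicE mem_set// mule1.
  move=> i /eqP it; rewrite indicE memNset ?mule0//.
  by move=> /= ti; apply: it; apply/val_inj.
rewrite ge0_integral_sum//; last 2 first.
- move=> k; apply: measurable_funeM; apply/measurable_EFinP.
  exact: measurable_indic.
- by move=> k t _; rewrite mule_ge0// lee_fin.
rewrite -sumEFin; apply: eq_bigr => k _.
rewrite ge0_integralZl_EFin//; last first.
  by apply/measurable_EFinP; exact: measurable_indic.
rewrite integral_indic// setIT muleC EFinM /cell_mass fineK//.
by apply: fin_num_measure; exact: mB.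
Qed.

Lemma sum_cell_mass : (\sum_(k < n.+1) cell_mass k = 1)%R.
Proof.
have := @integral_nearest (fun=> 1%R) (fun=> ler01).
rewrite integral_cst// [X in 1 * X](_ : _ = 1); last exact: probability_setT.
rewrite mule1 => /esym [].
by under eq_bigr do rewrite mulr1.
Qed.

Lemma nearest_preimageE (A : set X) : measurable (A : set (borel X)) ->
  mu ((fun t => p (nearest p n t)) @^-1` A) =
  \sum_(k < n.+1) ((cell_mass k)%:E * \d_(p k : borel X) A).
Proof.
move=> mA.
have := @integral_nearest (fun k => \1_A (p k)) (fun k => ler0n _ _).
rewrite -sumEFin => h; transitivity (\int[mu]_t (\1_A (p (nearest p n t)))%:E).
  rewrite -[LHS]/(mu _) -[X in mu X]setIT -integral_indic//.
  rewrite -[X in measurable X]setTI.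
  by apply: (@measurable_nearest _ _ p n measurableT [set k | A (p k)]).
by rewrite h; apply: eq_bigr => k _; rewrite EFinM diracE.
Qed.

Hypothesis pmu : forall a e, Defs.support mu a -> (0 < e)%R ->
  exists k, (mdist a (p k) < e)%R.
Hypothesis supp_mu : supported mu.

(** The Borel sets of [X * X] may exceed the product sigma-algebra, so measurable components do not
    suffice; on each cell the map coincides with the continuous [t |-> (t, p k)]. *)
Lemma measurable_graph_nearest :
  measurable_fun setT
    ((fun t => (t, p (nearest p n t))) : borel X -> borel (X * X)%type).
Proof.
move=> _ A mA; rewrite setTI.
have -> : (fun t => (t, p (nearest p n t))) @^-1` A =
  \bigcup_k (((fun t => (t, p k)) @^-1` A) `&` (nearest p n @^-1` [set k])).
  apply/seteqP; split => [t /= At|t [k _ [/= At ->//]]].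
  by exists (nearest p n t).
apply: bigcup_measurable => k _; apply: measurableI.
  rewrite -[X in measurable X]setTI.
  by apply: (@continuous_borel_measurable X (X * X)%type _
    (@continuous_pairr _ _ (p k))).
exact: measurable_nearest_fiber.
Qed.

(* A point [t] whose image lies outside of the support of the image measure has
   a basic neighbourhood [U] with [mu (U `&` cell) = 0]; there are countably
   many such pairs. *)
Lemma supported_graph_nearest (P : probability (borel (X * X)%type) R) :
  (forall A : set (borel (X * X)%type), measurable A ->
    P A = mu ((fun t => (t, p (nearest p n t))) @^-1` A)) ->
  supported P.
Proof.
move=> PE; pose phi t := (t, p (nearest p n t)).
have mS := borel_closed (@support_closed _ _ P).
rewrite /supported PE//.
have mphi : measurable (phi @^-1` Defs.support P : set (borel X)).
  by rewrite -[X in measurable X]setTI; apply: measurable_graph_nearest.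
pose B (x : nat * nat * nat) : set (borel X) :=
  [set t : X | (mdist t (p x.1.1) < x.1.2.+1%:R^-1)%R] `&`
  (nearest p n @^-1` [set x.2]).
have mB x : measurable (B x).
  apply: measurableI; last exact: measurable_nearest_fiber.
  by apply: borel_open; exact: open_mdist_ball.
pose Z j : set (borel X) :=
  if unpickle j is Some x then if mu (B x) == 0 then B x else set0 else set0.
have negZ : mu.-negligible (\bigcup_j Z j).
  apply: negligible_bigcup => j; rewrite /Z.
  case: (unpickle j) => [x|]; last exact: negligible_set0.
  case: ifPn => [/eqP Bx0|_]; last exact: negligible_set0.
  by exists (B x); split => //; exact: mB.
have cover : Defs.support mu `\` (phi @^-1` Defs.support P) `<=` \bigcup_j Z j.
  move=> t [st /= /existsNP[U /not_implyP[oU /not_implyP[Ut /negP]]]].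
  rewrite -leNgt => PU0.
  have /= : nbhs (phi t) U by apply: open_nbhs_nbhs.
  move=> [[U1 U2] /= [U1t U2t] U12].
  move: U1t; rewrite -nbhs_ballE => -[r /= r0 rU1].
  have r2 : (0 < r / 2)%R by rewrite divr_gt0.
  have [m _ hm] := near_infty_natSinv_lt (PosNum r2).
  have {}hm := hm m (leqnn m); rewrite /= in hm.
  have m0 : (0 < m.+1%:R^-1 :> R)%R by rewrite invr_gt0.
  have [k tk] := pmu st m0.
  pose x := (k, m, nearest p n t).
  exists (pickle x) => //; rewrite /Z pickleK.
  have Bt : B x t by [].
  suff -> : mu (B x) == 0 by [].
  rewrite eq_le measure_ge0 andbT (le_trans _ PU0)//.
  rewrite PE; last exact: borel_open.
  apply: le_measure; rewrite ?inE//.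
    rewrite -[X in measurable X]setTI; apply: measurable_graph_nearest => //.
    exact: borel_open.
  move=> z [/= zk zn]; apply: U12; split => /=.
    apply: rU1; rewrite ballEmdist /= (le_lt_trans (metric_triangle _ (p k) _))//.
    rewrite (metric_sym (p k)).
    by move: (m.+1%:R^-1)%R hm tk zk => c h1 h2 h3; lra.
  by rewrite zn; exact: nbhs_singleton U2t.
apply/eqP; rewrite eq_le probability_le1//=.
have mT := borel_closed (@support_closed _ _ mu).
rewrite -[leLHS]supp_mu.
rewrite (_ : Defs.support mu =
   (Defs.support mu `&` (phi @^-1` Defs.support P)) `|` (Defs.support mu `\` (phi @^-1` Defs.support P))); last by rewrite setUIDK.
rewrite measureU//; last 3 first.
- exact: measurableI.
- exact: measurableD.
- by rewrite setDE setIACA setICr setI0.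
rewrite [X in _ + X](_ : _ = 0) ?adde0.
  by apply: le_measure; rewrite ?inE//; exact: measurableI.
have [N [mN N0 ZN]] := @negligibleS _ (borel X) R mu _ _ cover negZ.
apply/eqP; rewrite eq_le measure_ge0 andbT -N0.
by apply: le_measure; rewrite ?inE//; exact: measurableD.
Qed.

(** The coupling is the image of [mu] under the graph of the nearest-point map. *)
Lemma wasserstein_nearest (nu : probability (borel X) R) :
  (forall A : set (borel X), measurable A ->
    nu A = \sum_(k < n.+1) ((cell_mass k)%:E * \d_(p k : borel X) A)) ->
  wasserstein mu nu <= \int[mu]_t (mdist (t : X) (p (nearest p n t)))%:E.
Proof.
move=> nuE.
pose phi : borel X -> borel (X * X)%type := fun t => (t, p (nearest p n t)).
have mphi : measurable_fun setT phi by exact: measurable_graph_nearest.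
pose phi' : {mfun borel X >-> borel (X * X)%type} :=
  HB.pack phi (isMeasurableFun.Build _ _ _ _ phi mphi).
pose P : probability (borel (X * X)%type) R := distribution mu phi'.
have PE A : P A = mu (phi @^-1` A) by [].
have cP : coupling mu nu P.
  split => [|A mA|A mA].
  - by apply: supported_graph_nearest => A _; exact: PE.
  - by [].
  - by rewrite PE nuE// -nearest_preimageE.
apply: (@le_trans _ _ (\int[P]_(z in setT)
    (mdist (z : X * X).1 (z : X * X).2)%:E)).
  by apply: ereal_inf_lbound; exists P.
rewrite (ge0_integral_distribution phi')//.
- apply/measurable_EFinP; apply: continuous_borel_measurableR.
  exact: continuous_mdist.
- by move=> z; rewrite lee_fin mdist_ge0.
Qed.

End wasserstein_bounds.

Section uniform_approximation.
Context {R : realType} {X : pmetricType R}.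
Local Open Scope ereal_scope.

Lemma finite_first_moment_weighted_dirac (s : seq (R * X))
    (nu : probability (borel X) R) :
  (forall x, x \in s -> (0 <= x.1)%R) ->
  (forall A : set (borel X), measurable A ->
    nu A = \sum_(x <- s) (x.1%:E * \d_(x.2 : borel X) A)) ->
  (forall f : borel X -> \bar R, measurable_fun setT f -> (forall t, 0 <= f t) ->
      \int[nu]_t f t = \sum_(x <- s) (x.1%:E * f x.2)) ->
  finite_first_moment nu.
Proof.
move=> s0 nuE nuI; split; first exact: supported_weighted_dirac nuE.
exists point; rewrite nuI.
- by under eq_bigr do rewrite -EFinM; rewrite sumEFin ltry.
- by apply/measurable_EFinP; exact: measurable_mdist.
- by move=> t; rewrite lee_fin mdist_ge0.
Qed.

Variables (mu : probability (borel X) R) (p : nat -> X) (n : nat).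
Hypothesis pmu : forall a e, Defs.support mu a -> (0 < e)%R ->
  exists k, (mdist a (p k) < e)%R.
Hypothesis supp_mu : supported mu.

(** Here [mu'] has the exact cell masses and [nu] the rounded ones. The regrouping identity is
    stated for all modules because it is used for measures, with values in [R], and for Karcher
    sums, with values in [hermOp E]. *)
Lemma uniform_approximation N : (0 < N)%N ->
  exists (mu' nu : probability (borel X) R) (a : 'I_N -> X) (c : nat -> R),
  [/\ finite_first_moment mu', finite_first_moment nu, uniform_on nu a,
      wasserstein mu mu' <= \int[mu]_t (mdist (t : X) (p (nearest p n t)))%:E &
      wasserstein mu' nu <= (N%:R^-1 * \sum_(k < n.+1) mdist (p k) (p 0%N))%:E] /\
  (forall k, [/\ 0 <= c k, c k <= cell_mass mu p n k &
     cell_mass mu p n k - c k <= N%:R^-1]%R) /\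
  (forall (V : lmodType R) (F : X -> V),
      N%:R^-1 *: \sum_(i < N) F (a i) =
      \sum_(k < n.+1) c k *: F (p k) + (1 - \sum_(k < n.+1) c k) *: F (p 0%N))%R.
Proof.
move=> N0; pose w := cell_mass mu p n.
have w0 k : (0 <= w k)%R by exact: cell_mass_ge0.
have w1 : (\sum_(k < n.+1) w k = 1)%R by exact: sum_cell_mass.
have [idx [c [cw cE]]] := round_weights N0 w0 w1.
have c0 k : (0 <= c k)%R by case: (cw k).
have cw0 k : (0 <= w k - c k)%R by rewrite subr_ge0; case: (cw k).
pose s1 := [seq (w (k : 'I_n.+1), p k) | k <- index_enum 'I_n.+1].
pose s2 := [seq ((N%:R^-1)%R : R, p (idx i)) | i <- index_enum 'I_N].
(* The coupling of [mu'] and [nu]: the mass [c k] stays at [p k], and the remainder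
   [w k - c k <= N^-1] is moved to [p 0]. *)
pose s3 := [seq (c (k : 'I_n.+1), (p k, p k)) | k <- index_enum 'I_n.+1] ++
  [seq ((w k - c k)%R, (p k, p 0%N)) | k : 'I_n.+1 <- index_enum 'I_n.+1].
have [|//|mu' [mu'E mu'I]] := @weighted_dirac_probability _ (borel X) R s1.
- by move=> x /mapP[k _ ->] /=.
- by rewrite /s1 big_map.
have [||nu [nuE nuI]] := @weighted_dirac_probability _ (borel X) R s2.
- by move=> x /mapP[k _ ->] /=; rewrite invr_ge0.
- rewrite /s2 big_map /= sumr_const card_ord -[RHS](@mulVf _ (N%:R)%R) ?mulr_natr//.
  by rewrite pnatr_eq0 -lt0n.
have [||P [PE PI]] := @weighted_dirac_probability _ (borel (X * X)%type) R s3.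
- by move=> x; rewrite mem_cat => /orP[] /mapP[k _ ->] /=.
- rewrite /s3 big_cat !big_map /= -big_split /= -[RHS]w1.
  by apply: eq_bigr => k _; rewrite addrC subrK.
have s10 x : x \in s1 -> (0 <= x.1)%R by move=> /mapP[k _ ->] /=.
have s20 x : x \in s2 -> (0 <= x.1)%R.
  by move=> /mapP[k _ ->] /=; rewrite invr_ge0.
have s30 x : x \in s3 -> (0 <= x.1)%R.
  by rewrite mem_cat => /orP[] /mapP[k _ ->] /=.
have mu'w (A : set (borel X)) : measurable A ->
    mu' A = \sum_(k < n.+1) ((w k)%:E * \d_(p k : borel X) A).
  by move=> mA; rewrite mu'E// big_map.
have nuF (A : set (borel X)) : measurable A ->
    nu A = (N%:R^-1)%:E * \sum_(i < N) \d_(p (idx i) : borel X) A.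
  by move=> mA; rewrite nuE// big_map /= ge0_sume_distrr.
have nu_c (A : set (borel X)) : measurable A -> nu A =
    \sum_(k < n.+1) ((c k)%:E * \d_(p k : borel X) A) +
    (1 - \sum_(k < n.+1) c k)%:E * \d_(p 0%N : borel X) A.
  move=> mA; rewrite nuF//.
  have h := congr1 EFin (cE R^o (fun k => \1_A (p k))%R).
  have -> : (N%:R^-1 : R)%R%:E * (\sum_(i < N) \d_(p (idx i) : borel X) A) =
     ((N%:R^-1 * \sum_(i < N) \1_A (p (idx i)))%R : R)%:E.
    by rewrite EFinM -sumEFin; congr (_ * _); apply: eq_bigr => i _; rewrite diracE.
  by rewrite h EFinD -sumEFin diracE.
exists mu', nu, (p \o idx), c; split; last first.
  by split => // V F; exact: (cE V (F \o p)).
split.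
- exact: finite_first_moment_weighted_dirac s10 mu'E mu'I.
- exact: finite_first_moment_weighted_dirac s20 nuE nuI.
- by move=> A mA; rewrite nuF.
- exact: wasserstein_nearest.
have cP : coupling mu' nu P.
  have mpre1 (A : set (borel X)) : measurable A ->
      measurable ([set z : X * X | A z.1] : set (borel (X * X)%type)).
    move=> mA; rewrite -[X in measurable X]setTI.
    apply: (@continuous_borel_measurable _ _ (fst : (X * X)%type -> X)) => //.
    by move=> z; exact: cvg_fst.
  have mpre2 (A : set (borel X)) : measurable A ->
      measurable ([set z : X * X | A z.2] : set (borel (X * X)%type)).
    move=> mA; rewrite -[X in measurable X]setTI.
    apply: (@continuous_borel_measurable _ _ (snd : (X * X)%type -> X)) => //.
    by move=> z; exact: cvg_snd.
  split.
  - exact: supported_weighted_dirac s30 PE.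
  - move=> A mA; rewrite PE; last exact: mpre1.
    rewrite mu'w// /s3 big_cat !big_map /= -big_split /=.
    apply: eq_bigr => k _; rewrite !diracE.
    have -> : ((p k, p k) \in [set z : X * X | A z.1]) = (p k \in A) by [].
    have -> : ((p k, p 0%N) \in [set z : X * X | A z.1]) = (p k \in A) by [].
    by rewrite -ge0_muleDl ?lee_fin// -EFinD addrC subrK.
  - move=> A mA; rewrite PE; last exact: mpre2.
    rewrite nu_c// /s3 big_cat !big_map /=; congr (_ + _).
    by rewrite -w1 -sumrB -sumEFin ge0_sume_distrl// => k _; rewrite lee_fin.
apply: (@le_trans _ _ (\int[P]_(z in setT)
    (mdist (z : X * X).1 (z : X * X).2)%:E)).
  by apply: ereal_inf_lbound; exists P.
rewrite PI; last 2 first.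
- apply/measurable_EFinP; apply: continuous_borel_measurableR.
  exact: continuous_mdist.
- by move=> z; rewrite lee_fin mdist_ge0.
rewrite /s3 big_cat !big_map /= big1 ?add0e; last first.
  by move=> k _; rewrite mdistxx mule0.
rewrite mulr_sumr -sumEFin; apply: lee_sum => k _.
rewrite -EFinM lee_fin ler_wpM2r ?mdist_ge0//.
by case: (cw k).
Qed.

End uniform_approximation.

(** * The Karcher equation *)

Lemma dominated_cvg0 d (T : measurableType d) (R : realType)
    (mu : probability T R) (h : nat -> T -> R) (g : T -> R) :
  (forall n, measurable_fun setT (h n)) ->
  (forall n t, 0 <= h n t <= g t) ->
  mu.-integrable setT (EFin \o g) ->
  {ae mu, forall t, h n t @[n --> \oo] --> (0 : R)} ->
  (\int[mu]_t (h n t)%:E)%E @[n --> \oo] --> 0%E.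
Proof.
move=> mh hg ig h0.
have [||||_ _] := @dominated_convergence _ _ _ mu setT measurableT
  (fun n t => (h n t)%:E) (fun=> 0%E) (EFin \o g) _ _ _ ig.
- by move=> n; apply/measurable_EFinP.
- exact: measurable_cst.
- apply: filterS h0 => t ht _.
  by apply/fine_cvgP; split; [exact: nearW|exact: ht].
- apply: aeW => t n _ /=; have /andP[h1 h2] := hg n t.
  by rewrite lee_fin ger0_norm.
by rewrite integral0.
Qed.

Lemma lipschitz1_measurable (R : realType) (X : pmetricType R) (G : X -> R) :
  (forall a b, `|G a - G b| <= mdist a b) ->
  measurable_fun setT (G : borel X -> R).
Proof.
move=> lG; apply: continuous_borel_measurableR => a.
apply/cvgrPdist_lt => e e0; apply: filterS (nbhsx_ballx a e e0) => b.
by rewrite ballEmdist /=; exact: le_lt_trans.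
Qed.

Section nearest_simple.
Context {R : realType} {X : pmetricType R} {V : normedModType R}.
Variables (mu : probability (borel X) R) (p : nat -> X) (n : nat) (F : nat -> V).

Let s : borel X -> V := fun t => F (nearest p n t).

Lemma simple_fun_nearest : simple_fun s.
Proof.
split.
  apply: (@sub_finite_set _ _ (F @` `I_n.+1)).
    by move=> _ [t _ <-]; exists (nearest p n t) => //=; rewrite ltnS nearest_le.
  exact/finite_image/finite_II.
move=> v; rewrite -[X in measurable X]setTI.
exact: (@measurable_nearest _ _ p n measurableT [set k | F k = v]).
Qed.

(** [F] may take the same value on several cells, so the sum over values has to be split into a sum
    over cells. *)
Lemma simple_integral_nearest :
  simple_integral mu s = \sum_(k < n.+1) cell_mass mu p n k *: F k.
Proof.
pose r := undup [seq F k | k <- iota 0 n.+1].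
have rs : range s `<=` [set` r].
  move=> _ [t _ <-] /=; rewrite mem_undup; apply/mapP.
  by exists (nearest p n t) => //; rewrite mem_iota ltnS nearest_le.
have muE v : fine (mu (s @^-1` [set v])) =
    \sum_(k < n.+1) cell_mass mu p n k * (F k == v)%:R.
  have := @integral_nearest _ _ mu p n (fun k => (F k == v)%:R) (fun k => ler0n _ _).
  move=> /(congr1 fine) /= <-; congr fine.
  transitivity (\int[mu]_t (\1_(s @^-1` [set v]) t)%:E)%E.
    rewrite integral_indic// ?setIT//; last first.
      by case: simple_fun_nearest => _ /(_ v).
  apply: eq_integral => t _; rewrite indicE; congr (_%:R)%:E.
  by congr nat_of_bool; apply/idP/eqP; rewrite inE.
rewrite /simple_integral (fsbig_widen _ [set` r])//; last first.
  move=> v [_ /= vs]; rewrite (_ : _ @^-1` _ = set0) ?measure0 ?scale0r//.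
  by apply/seteqP; split => // t /= tv; apply: vs; exists t.
rewrite -fsbig_seq ?undup_uniq//.
under eq_bigr do rewrite muE scaler_suml.
rewrite exchange_big /=; apply: eq_bigr => k _.
rewrite (bigD1_seq (F k)) ?undup_uniq//=; last first.
  by rewrite mem_undup; apply/mapP; exists (val k) => //; rewrite mem_iota /=.
rewrite eqxx mulr1 big1 ?addr0// => v /negPf vk.
by rewrite eq_sym vk mulr0 scale0r.
Qed.

End nearest_simple.

Section karcher_equation.
Context {R : realType} {E : hilbertType R}.
Local Notation Omega := (posCone E).
Variable L : probability (borel Omega) R -> Omega.
Hypothesis hL : karcher_barycenter_map L.
Variable mu : probability (borel Omega) R.
Hypothesis hmu : finite_first_moment mu.

Let x := L mu.

Lemma integrable_mdist (q : Omega) :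
  mu.-integrable setT (fun t : borel Omega => (mdist (t : Omega) q)%:E).
Proof.
have [_ [y yfin]] := hmu.
have my q' : measurable_fun setT
    (fun t : borel Omega => (mdist (t : Omega) q')%:E).
  by apply/measurable_EFinP; exact: measurable_mdist.
have iy : mu.-integrable setT
    (fun t : borel Omega => (mdist (t : Omega) y)%:E).
  apply/integrableP; split => //; apply: le_lt_trans yfin.
  rewrite le_eqVlt; apply/orP; left; apply/eqP.
  by apply: eq_integral => t _; rewrite gee0_abs// lee_fin mdist_ge0.
apply: (@le_integrable _ _ _ mu setT measurableT _
  (fun t : borel Omega =>
     (mdist (t : Omega) y)%:E + (cst (mdist y q)%:E t))%E) => //.
  move=> t _ /=; rewrite lee_fin !ger0_norm ?addr_ge0 ?mdist_ge0//.
  exact: metric_triangle.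
apply: integrableD => //; exact: finite_measure_integrable_cst.
Qed.

Lemma karcher_log_nearest_measurable (p : nat -> Omega) n :
  measurable_fun setT (fun t : borel Omega =>
    `|karcher_log x t - karcher_log x (p (nearest p n t))|).
Proof.
apply: (@measurable_nearest_dep _ _ p n
  (fun k (t : borel Omega) => `|karcher_log x t - karcher_log x (p k)|)).
move=> k; apply: lipschitz1_measurable => a b.
rewrite (le_trans (ler_dist_dist _ _))// opprB addrA subrK.
exact: karcher_log_dist.
Qed.

Variable p : nat -> Omega.
Hypothesis pmu : forall a e, Defs.support mu a -> 0 < e ->
  exists k, mdist a (p k) < e.

Let mean_dist n : \bar R :=
  (\int[mu]_t (mdist (t : Omega) (p (nearest p n t)))%:E)%E.

Lemma ae_support (Q : borel Omega -> Prop) :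
  (forall t, Defs.support mu t -> Q t) -> {ae mu, forall t, Q t}.
Proof.
move=> SQ; have [smu _] := hmu.
have mS := borel_closed (@support_closed _ _ mu).
exists (~` Defs.support mu); split; first exact: measurableC.
  by rewrite probability_setC// smu subee.
by move=> t /= nQ st; apply: nQ; exact: SQ.
Qed.

Lemma mean_dist_cvg0 : mean_dist n @[n --> \oo] --> 0%E.
Proof.
apply: (@dominated_cvg0 _ _ _ mu (fun n (t : borel Omega) =>
  mdist (t : Omega) (p (nearest p n t)))
  (fun t : borel Omega => mdist (t : Omega) (p 0%N))).
- by move=> n; exact: measurable_mdist_nearest.
- by move=> n t; rewrite mdist_ge0 mdist_nearest.
- exact: integrable_mdist.
- apply: ae_support => t st; apply: cvg_mdist_nearest => e; exact: pmu.
Qed.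

Lemma mean_dist_ge0 n : (0 <= mean_dist n)%E.
Proof. by apply: integral_ge0 => t _; rewrite lee_fin mdist_ge0. Qed.

Lemma mean_dist_le n : (mean_dist n <= (fine (mean_dist 0%N))%:E)%E.
Proof.
rewrite fineK; last first.
  rewrite ge0_fin_numE ?mean_dist_ge0// /mean_dist /=.
  have /integrableP[_] := integrable_mdist (p 0%N).
  apply: le_lt_trans; rewrite le_eqVlt; apply/orP; left; apply/eqP.
  by apply: eq_integral => t _ /=; rewrite ger0_norm ?mdist_ge0.
apply: ge0_le_integral => //.
- by move=> t _; rewrite lee_fin mdist_ge0.
- by apply/measurable_EFinP; exact: measurable_mdist_nearest.
- by apply/measurable_EFinP; exact: measurable_mdist_nearest.
- by move=> t _; rewrite lee_fin mdist_nearest.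
Qed.

Lemma mean_dist_fin_num n : mean_dist n \is a fin_num.
Proof.
by rewrite ge0_fin_numE ?mean_dist_ge0// (le_lt_trans (mean_dist_le n))// ltry.
Qed.

(** [xc.1] is the barycenter of the uniform measure, and [xc.2] gives its masses before the excess
    is put on [p 0]. The last clause is its Karcher equation regrouped by cells. *)
Lemma barycenter_approximation n : exists xc : Omega * (nat -> R),
  [/\ thompson xc.1 x <= fine (mean_dist n) + n.+1%:R^-1,
      forall k, 0 <= cell_mass mu p n k - xc.2 k,
      \sum_(k < n.+1) (cell_mass mu p n k - xc.2 k) * thompson (p k) (p 0%N) <= n.+1%:R^-1 &
      \sum_(k < n.+1) xc.2 k *: karcher_log xc.1 (p k) +
        (1 - \sum_(k < n.+1) xc.2 k) *: karcher_log xc.1 (p 0%N) = 0].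
Proof.
have [supp_mu _] := hmu.
pose S := \sum_(k < n.+1) mdist (p k) (p 0%N).
have S0 : 0 <= S by apply: sumr_ge0 => k _; exact: mdist_ge0.
(* [N] exceeds [(n+1) S], so that the rounding cost [S / N] is at most [1 / (n+1)]. *)
pose N := (Num.truncn (n.+1%:R * S)).+1.
have N_gt0 : 0 < N%:R :> R by rewrite ltr0n.
have NS : N%:R^-1 * S <= n.+1%:R^-1.
  rewrite ler_pdivrMl// mulrC ler_pdivlMl ?ltr0n//.
  by rewrite ltW// -truncn_lt_nat// mulr_ge0.
have [mu' [nu [a [c [[m1 m2 ua W1 W2] [cw cE]]]]]] :=
  @uniform_approximation _ _ mu p n pmu supp_mu N isT.
have [hLk hLd] := hL.
exists (L nu, c); split => /=.
- rewrite -lee_fin EFinD fineK ?mean_dist_fin_num//.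
  apply: (@le_trans _ _
    ((mdist (L mu) (L mu'))%:E + (mdist (L mu') (L nu))%:E)%E).
    by rewrite -EFinD lee_fin thompson_sym; exact: thompson_triangle.
  apply: leeD; first exact: le_trans (hLd _ _ hmu m1) W1.
  apply: (le_trans (hLd _ _ m1 m2)); apply: (le_trans W2).
  by rewrite lee_fin.
- by move=> k; rewrite subr_ge0; case: (cw k).
- apply: le_trans NS; rewrite /S mulr_sumr; apply: ler_sum => k _.
  by apply: ler_wpM2r; [exact: (mdist_ge0 (p k) (p 0%N))|case: (cw k)].
- by rewrite -(cE _ (karcher_log (L nu))) (hLk nu N a)// scaler0.
Qed.

Lemma simple_integral_cvg0 :
  \sum_(k < n.+1) cell_mass mu p n k *: karcher_log x (p k) @[n --> \oo] --> (0 : hermOp E).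
Proof.
have [xc xcP] := choice barycenter_approximation.
pose x_ n := (xc n).1; pose c n := (xc n).2.
have x_cvg : thompson (x_ n) x @[n --> \oo] --> (0 : R).
  apply: (@squeeze_cvgr _ _ _ _ (fun=> 0) (fun n => fine (mean_dist n) + n.+1%:R^-1)).
  - apply: nearW => n; case: (xcP n) => -> _ _ _.
    by rewrite -mdist_thompson mdist_ge0.
  - exact: cvg_cst.
  - rewrite -[0 : R]addr0; apply: cvgD; last exact: cvg_harmonic.
    exact: fine_cvg mean_dist_cvg0.
have x_bound n : thompson (x_ n) x <= fine (mean_dist 0%N) + 1.
  have [h _ _ _] := xcP n; apply: (le_trans h); apply: lerD.
    have := mean_dist_le n.
    by rewrite -{1}(fineK (mean_dist_fin_num n)) lee_fin.
  by rewrite invf_le1 ?ler1n ?ltr0n.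
pose h n k := `|karcher_log x (p k) - karcher_log (x_ n) (p k)|.
have int_h : (\int[mu]_t (h n (nearest p n t))%:E)%E @[n --> \oo] --> 0%E.
  (* With [q] the point nearest to [t], the two logarithms at [q] have norms at most [d(q, x)] and
     [d(q, x) + d(x_n, x)], where [d(q, x) <= d(t, p 0) + d(t, x)]. *)
  pose g (t : borel Omega) := 2 * mdist (t : Omega) (p 0%N) +
    2 * mdist (t : Omega) x + (fine (mean_dist 0%N) + 1).
  apply: (@dominated_cvg0 _ _ _ mu (fun n (t : borel Omega) => h n (nearest p n t)) g).
  - move=> n; exact: (@measurable_nearest_dep _ _ p n (fun k _ => h n k)).
  - move=> n t; rewrite normr_ge0 /=; set q := p (nearest p n t).
    have tq : mdist (t : Omega) q <= mdist (t : Omega) (p 0%N).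
      exact: mdist_nearest.
    have h1 : thompson q x <= mdist (t : Omega) q + mdist (t : Omega) x.
      rewrite (metric_sym (t : Omega) q).
      exact: (@thompson_triangle _ _ (t : Omega) q x).
    have h2 : thompson q (x_ n) <= thompson q x + thompson (x_ n) x.
      by rewrite (thompson_sym (x_ n)); exact: thompson_triangle.
    rewrite (le_trans (ler_normB _ _))//.
    have := karcher_log_norm x q; have := karcher_log_norm (x_ n) q.
    have := x_bound n; rewrite /g; lra.
  - have -> : EFin \o g = (fun t : borel Omega =>
        (2%:E * (mdist (t : Omega) (p 0%N))%:E + 2%:E * (mdist (t : Omega) x)%:E) +
        cst (fine (mean_dist 0%N) + 1)%:E t)%E by [].
    apply: integrableD => //; last exact: finite_measure_integrable_cst.
    by apply: integrableD => //; apply: integrableZl => //; exact: integrable_mdist.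
  - apply: ae_support => t st.
    have c1 : `|karcher_log x t - karcher_log (x_ n) t| @[n --> \oo] --> (0 : R).
      rewrite -(@normr0 _ (hermOp E)) -(subrr (karcher_log x t)).
      by apply: cvg_norm; apply: cvgB; [exact: cvg_cst|exact: karcher_log_cvg].
    have c2 : mdist (t : Omega) (p (nearest p n t)) @[n --> \oo] --> (0 : R).
      by apply: cvg_mdist_nearest => e; exact: pmu.
    apply: (@squeeze_cvgr _ _ _ _ (fun=> 0) (fun n =>
      `|karcher_log x t - karcher_log (x_ n) t| +
      (mdist (t : Omega) (p (nearest p n t)) + mdist (t : Omega) (p (nearest p n t))))).
    + apply: nearW => n; rewrite normr_ge0 /= /h; set q := p (nearest p n t).
      (* The moving point [q] is replaced by the fixed [t], where continuity in the base point
         applies; each of the two replacements costs at most [d(t, q)]. *)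
      have -> : karcher_log x q - karcher_log (x_ n) q =
        (karcher_log x t - karcher_log (x_ n) t) +
        ((karcher_log (x_ n) t - karcher_log (x_ n) q) - (karcher_log x t - karcher_log x q)).
        rewrite addrA [X in _ = X - _]addrA subrK opprB.
        by rewrite [RHS]addrC addrA subrK.
      rewrite (le_trans (ler_normD _ _))// lerD2l (le_trans (ler_normB _ _))//.
      by rewrite lerD// karcher_log_dist.
    + exact: cvg_cst.
    + by rewrite -[0 : R]addr0; apply: cvgD => //; rewrite -[0 : R]addr0; apply: cvgD.
have bnd n : `|\sum_(k < n.+1) cell_mass mu p n k *: karcher_log x (p k)| <=
    fine (\int[mu]_t (h n (nearest p n t))%:E)%E + n.+1%:R^-1.
  have [_ c0 cS cE] := xcP n; rewrite -/(x_ n) -/(c n) in c0 cS cE.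
  rewrite integral_nearest ?fine_EFin => [|k]; last exact: normr_ge0.
  pose w := cell_mass mu p n.
  (* The first sum changes the base point. The second is [\sum_k w k *: karcher_log (x_ n) (p k)]
     minus the vanishing Karcher sum of the rounded masses, rewritten with [\sum_k w k = 1]; its
     norm is bounded by the transport cost of the rounding. *)
  have -> : \sum_(k < n.+1) w k *: karcher_log x (p k) =
    \sum_(k < n.+1) w k *: (karcher_log x (p k) - karcher_log (x_ n) (p k)) +
    \sum_(k < n.+1) (w k - c n k) *: (karcher_log (x_ n) (p k) - karcher_log (x_ n) (p 0%N)).
    have <- : \sum_(k < n.+1) (w k *: karcher_log x (p k) - w k *: karcher_log (x_ n) (p k)) =
      \sum_(k < n.+1) w k *: (karcher_log x (p k) - karcher_log (x_ n) (p k)).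
      by apply: eq_bigr => k _; rewrite scalerBr.
    have <- : \sum_(k < n.+1) ((w k - c n k) *: karcher_log (x_ n) (p k) -
        (w k - c n k) *: karcher_log (x_ n) (p 0%N)) = \sum_(k < n.+1)
        (w k - c n k) *: (karcher_log (x_ n) (p k) - karcher_log (x_ n) (p 0%N)).
      by apply: eq_bigr => k _; rewrite scalerBr.
    have wc : \sum_(k < n.+1) (w k - c n k) *: karcher_log (x_ n) (p k) -
       \sum_(k < n.+1) (w k - c n k) *: karcher_log (x_ n) (p 0%N) =
       \sum_(k < n.+1) w k *: karcher_log (x_ n) (p k).
      rewrite -scaler_suml sumrB /w sum_cell_mass.
      under eq_bigr do rewrite scalerBl.
      rewrite sumrB -addrA -opprD cE subr0//.
    by rewrite sumrB [X in _ = _ + X]sumrB wc subrK.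
  rewrite (le_trans (ler_normD _ _))//; apply: lerD.
    rewrite (le_trans (ler_norm_sum _ _ _))//; apply: ler_sum => k _.
    by rewrite normrZ ger0_norm ?cell_mass_ge0.
  apply: le_trans cS; rewrite (le_trans (ler_norm_sum _ _ _))//.
  apply: ler_sum => k _; rewrite normrZ ger0_norm// ler_wpM2l//.
  exact: karcher_log_dist.
have cv : fine (\int[mu]_t (h n (nearest p n t))%:E)%E + n.+1%:R^-1 @[n --> \oo] --> (0 : R).
  rewrite -[0 : R]addr0; apply: cvgD; last exact: cvg_harmonic.
  exact: fine_cvg int_h.
apply/cvgrPdist_le => e e0.
move/cvgrPdist_le : cv => /(_ _ e0); apply: filterS => n.
rewrite !sub0r !normrN => le_e; apply: (le_trans (bnd n)).
exact: le_trans (ler_norm _) le_e.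
Qed.

(** The approximating simple functions evaluate the logarithm at the nearest point; by the Lipschitz
    bound their error is at most the distance to that point, both pointwise and in mean. *)
Lemma karcher_equation : is_bochner_integral mu (karcher_log x) 0.
Proof.
exists (fun n t => karcher_log x (p (nearest p n t))); split.
- move=> n; exact: (@simple_fun_nearest _ _ _ p n (karcher_log x \o p)).
- apply: ae_support => t st; apply/cvgrPdist_le => e e0.
  have c2 : mdist (t : Omega) (p (nearest p n t)) @[n --> \oo] --> (0 : R).
    by apply: cvg_mdist_nearest => d; exact: pmu.
  move/cvgrPdist_le : c2 => /(_ _ e0); apply: filterS => n.
  rewrite sub0r normrN ger0_norm ?mdist_ge0//; apply: le_trans.
  exact: karcher_log_dist.
- apply: (@squeeze_cvge _ _ _ _ (fun=> 0%E) _ mean_dist); last exact: mean_dist_cvg0.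
  + apply: nearW => n; apply/andP; split.
      by apply: integral_ge0 => t _; rewrite lee_fin.
    apply: ge0_le_integral => //.
    * by apply/measurable_EFinP; exact: karcher_log_nearest_measurable.
    * by apply/measurable_EFinP; exact: measurable_mdist_nearest.
    * by move=> t _; rewrite lee_fin karcher_log_dist.
  + exact: cvg_cst.
- rewrite (_ : (fun n => _) = fun n =>
    \sum_(k < n.+1) cell_mass mu p n k *: karcher_log x (p k)).
    exact: simple_integral_cvg0.
  apply/funext => n.
  exact: (@simple_integral_nearest _ _ _ mu p n (karcher_log x \o p)).
Qed.

End karcher_equation.

Theorem proposition4p3 (R : realType) (E : hilbertType R)
  (L : probability (borel (posCone E)) R -> posCone E)
  (hL : karcher_barycenter_map L)
  (mu : probability (borel (posCone E)) R)
  (hmu : finite_first_moment mu) :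
  is_bochner_integral mu (karcher_log (L mu)) 0.
Proof.
have [p pmu] := dense_sequence_support mu.
exact: (@karcher_equation _ _ _ hL _ hmu p pmu).
Qed.
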